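(* Let $B$ be a non-selfinjective monomial algebra with $s$ projective-injective indecomposable modules (up to isomorphism). Then $$\operatorname{domdim}(B)\le 2s.$$
   Context: Standing assumptions: $K$ is an arbitrary field; algebras are finite-dimensional connected $K$-algebras given by quiver and relations. Modules are finitely generated right modules. $B$ is selfinjective if the right regular module $B$ is injective. A monomial algebra is a quiver algebra $KQ/I$ ($Q$ a finite quiver) with admissible ideal $I$ generated by zero relations (i.e. by paths). Dominant dimension: let $0\to B\to I_0\to I_1\to I_2\to\cdots$ be a minimal injective coresolution of the right regular module $B$. If $I_0$ is not projective, $\operatorname{domdim}(B):=0$; otherwise $\operatorname{domdim}(B):=\sup\{m\mid I_i \text{ is projective for } i=0,1,\dots,m\}+1$ (possibly $\infty$). *)

(* Defs.v *)
From HB Require Import structures.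
From mathcomp Require Import all_boot all_order all_algebra all_field.
From mathcomp Require Import finmap.
From mathcomp.multinomials Require Import monalg.

Set Implicit Arguments.
Unset Strict Implicit.
Unset Printing Implicit Defensive.

Import GRing.Theory.
Local Open Scope ring_scope.

(* A finite quiver is required to have a vertex, so that its path algebra is a
   nonzero ring. *)
Record quiver := Quiver {
  vertex : finType;
  arrow : finType;
  src : arrow -> vertex;
  tgt : arrow -> vertex;
  vertex_gt0 : (0 < #|vertex|)%N
}.

(* [walk v s]: the word [s] of arrows, read from left to right, is a path of
   the quiver starting at [v]; [walk_end v s] is the vertex where it ends. *)
Fixpoint walk (Q : quiver) (v : vertex Q) (s : seq (arrow Q)) : bool :=
  if s is a :: s' then (src a == v) && walk (tgt a) s' else true.

Fixpoint walk_end (Q : quiver) (v : vertex Q) (s : seq (arrow Q)) : vertex Q :=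
  if s is a :: s' then walk_end (tgt a) s' else v.

(* The paths of length 0 are the trivial paths [(v, [::])]. *)
Record qpath (Q : quiver) := QPath {
  qpath_val : vertex Q * seq (arrow Q);
  qpath_walk : walk qpath_val.1 qpath_val.2
}.
HB.instance Definition _ (Q : quiver) := [isSub of qpath Q for @qpath_val Q].
HB.instance Definition _ (Q : quiver) := [Choice of qpath Q by <:].

Lemma qpath_val_inj (Q : quiver) : injective (@qpath_val Q).
Proof. exact: val_inj. Qed.

Definition qsrc (Q : quiver) (p : qpath Q) : vertex Q := (qpath_val p).1.
Definition qword (Q : quiver) (p : qpath Q) : seq (arrow Q) := (qpath_val p).2.
Definition qtgt (Q : quiver) (p : qpath Q) : vertex Q :=
  walk_end (qsrc p) (qword p).

Definition trivial_path (Q : quiver) (v : vertex Q) : qpath Q :=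
  @QPath Q (v, [::]) isT.

Lemma walk1 (Q : quiver) (a : arrow Q) : walk (src a) [:: a].
Proof. by rewrite /= eqxx. Qed.

Definition arrow_path (Q : quiver) (a : arrow Q) : qpath Q :=
  @QPath Q (src a, [:: a]) (walk1 a).

Lemma walk_cat (Q : quiver) (v : vertex Q) (s t : seq (arrow Q)) :
  walk v (s ++ t) = walk v s && walk (walk_end v s) t.
Proof. by elim: s v => [//|a s IHs] v /=; rewrite IHs andbA. Qed.

Lemma walk_end_cat (Q : quiver) (v : vertex Q) (s t : seq (arrow Q)) :
  walk_end v (s ++ t) = walk_end (walk_end v s) t.
Proof. by elim: s v => [//|a s IHs] v /=. Qed.

(* The concatenation "first p, then q"; [None] when [p] and [q] do not
   compose. *)
Definition qcomp (Q : quiver) (p q : qpath Q) : option (qpath Q) :=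
  if qtgt p == qsrc q
  then insub (qsrc p, qword p ++ qword q)
  else None.

Lemma qcompP (Q : quiver) (p q : qpath Q) :
  if qtgt p == qsrc q then
    exists2 r, qcomp p q = Some r & qpath_val r = (qsrc p, qword p ++ qword q)
  else qcomp p q = None.
Proof.
rewrite /qcomp; case: eqP => // e.
have w : walk (qsrc p) (qword p ++ qword q).
  by rewrite walk_cat -/(qtgt p) e (qpath_walk p) (qpath_walk q).
by case: insubP => [r _ <-|/=]; [exists r | rewrite w].
Qed.

Lemma qcompA (Q : quiver) (p q r : qpath Q) :
  obind (qcomp p) (qcomp q r) = obind (fun u => qcomp u r) (qcomp p q).
Proof.
have := qcompP p q; have := qcompP q r.
have tgtw w : qpath_val w = (qsrc p, qword p ++ qword q) -> qtgt p = qsrc q ->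
    qtgt w = qtgt q.
  by move=> vw e; rewrite /qtgt /qsrc /qword vw /= walk_end_cat -/(qtgt p) e.
case: ifPn => [/eqP e [u Eu vu]|ne Eu]; case: ifPn => [/eqP e' [w Ew vw]|ne' Ew];
  rewrite Eu Ew //=.
- have := qcompP p u; have := qcompP w r.
  rewrite (tgtw w) // e.
  have -> : qsrc u = qsrc q by rewrite /qsrc vu.
  rewrite e' !eqxx => -[x -> vx] [y -> vy]; congr Some; apply: qpath_val_inj.
  by rewrite vx vy /qword /qsrc vu vw /= catA.
- have := qcompP p u.
  have -> : qsrc u = qsrc q by rewrite /qsrc vu.
  by rewrite (negbTE ne').
- have := qcompP w r.
  by rewrite (tgtw w) // (negbTE ne).
Qed.

Lemma qcomp_triv (Q : quiver) (v : vertex Q) (p : qpath Q) :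
  qcomp (trivial_path v) p = if v == qsrc p then Some p else None.
Proof.
have := qcompP (trivial_path v) p.
rewrite /qtgt /= /qsrc /=; case: eqP => [->|//] [r -> vr].
by congr Some; apply: qpath_val_inj; rewrite vr /= /qword; case: (qpath_val p).
Qed.

Lemma qcompp_triv (Q : quiver) (v : vertex Q) (p : qpath Q) :
  qcomp p (trivial_path v) = if qtgt p == v then Some p else None.
Proof.
have := qcompP p (trivial_path v).
rewrite {2}/qsrc /=; case: eqP => [_|//] [r -> vr].
by congr Some; apply: qpath_val_inj; rewrite vr cats0 /qsrc /qword; case: (qpath_val p).
Qed.

(* The path algebra KQ: the K-vector space with basis the paths of Q, with the
   bilinear multiplication given by concatenation of paths. *)
Definition path_alg (K : fieldType) (Q : quiver) : Type := {malg K[qpath Q]}.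
HB.instance Definition _ (K : fieldType) (Q : quiver) :=
  GRing.Lmodule.copy (path_alg K Q) {malg K[qpath Q]}.

HB.lock Definition path_elt (K : fieldType) (Q : quiver) (p : qpath Q) : path_alg K Q :=
  mkmalgU p 1.

Definition opath_elt (K : fieldType) (Q : quiver) (o : option (qpath Q)) :
  path_alg K Q := oapp (@path_elt K Q) 0 o.

HB.lock Definition path_mul (K : fieldType) (Q : quiver) (x y : path_alg K Q) :
    path_alg K Q :=
  \sum_(p <- msupp (x : {malg K[qpath Q]})) \sum_(q <- msupp (y : {malg K[qpath Q]}))
    (mcoeff p x * mcoeff q y) *: opath_elt K (qcomp p q).

Definition path_one (K : fieldType) (Q : quiver) : path_alg K Q :=
  \sum_(v : vertex Q) path_elt K (trivial_path v).

Lemma path_mulw (K : fieldType) (Q : quiver) (d1 d2 : {fset qpath Q})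
    (x y : path_alg K Q) :
  (msupp (x : {malg K[qpath Q]}) `<=` d1)%fset ->
  (msupp (y : {malg K[qpath Q]}) `<=` d2)%fset ->
  path_mul x y = \sum_(p <- d1) \sum_(q <- d2)
    (mcoeff p x * mcoeff q y) *: opath_elt K (qcomp p q).
Proof.
move=> le1 le2; rewrite path_mul.unlock (big_fset_incl _ le1) /=; last first.
  move=> p _ /mcoeff_outdom->; rewrite big1 // => q _; by rewrite mul0r scale0r.
apply: eq_bigr => p _; rewrite (big_fset_incl _ le2) //=.
by move=> q _ /mcoeff_outdom->; rewrite mulr0 scale0r.
Qed.

Lemma path_mulDl (K : fieldType) (Q : quiver) :
  left_distributive (@path_mul K Q) +%R.
Proof.
move=> x y z.
pose d := (msupp (x : {malg K[qpath Q]}) `|` msupp (y : {malg K[qpath Q]}))%fset.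
rewrite (@path_mulw _ _ d _ x z (fsubsetUl _ _) (fsubset_refl _)).
rewrite (@path_mulw _ _ d _ y z (fsubsetUr _ _) (fsubset_refl _)).
rewrite (@path_mulw _ _ d _ (x + y) z (msuppD_le _ _) (fsubset_refl _)).
rewrite -big_split; apply: eq_bigr => p _; rewrite -big_split; apply: eq_bigr => q _.
by rewrite mcoeffD mulrDl scalerDl.
Qed.

Lemma path_mulDr (K : fieldType) (Q : quiver) :
  right_distributive (@path_mul K Q) +%R.
Proof.
move=> z x y.
pose d := (msupp (x : {malg K[qpath Q]}) `|` msupp (y : {malg K[qpath Q]}))%fset.
rewrite (@path_mulw _ _ _ d z x (fsubset_refl _) (fsubsetUl _ _)).
rewrite (@path_mulw _ _ _ d z y (fsubset_refl _) (fsubsetUr _ _)).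
rewrite (@path_mulw _ _ _ d z (x + y) (fsubset_refl _) (msuppD_le _ _)).
rewrite -big_split; apply: eq_bigr => p _; rewrite -big_split; apply: eq_bigr => q _.
by rewrite mcoeffD mulrDr scalerDl.
Qed.

Lemma path_mulZl (K : fieldType) (Q : quiver) (c : K) (x y : path_alg K Q) :
  path_mul (c *: x) y = c *: path_mul x y.
Proof.
rewrite (@path_mulw _ _ _ _ (c *: x) y (msuppZ_le _ _) (fsubset_refl _)).
rewrite path_mul.unlock scaler_sumr; apply: eq_bigr => p _.
rewrite scaler_sumr; apply: eq_bigr => q _.
by rewrite mcoeffZ scalerA mulrA.
Qed.

Lemma path_mulZr (K : fieldType) (Q : quiver) (c : K) (x y : path_alg K Q) :
  path_mul x (c *: y) = c *: path_mul x y.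
Proof.
rewrite (@path_mulw _ _ _ _ x (c *: y) (fsubset_refl _) (msuppZ_le _ _)).
rewrite path_mul.unlock scaler_sumr; apply: eq_bigr => p _.
rewrite scaler_sumr; apply: eq_bigr => q _.
by rewrite mcoeffZ scalerA mulrCA.
Qed.

Lemma path_mul0l (K : fieldType) (Q : quiver) (x : path_alg K Q) :
  path_mul 0 x = 0.
Proof. by rewrite -{1}(scale0r (0 : path_alg K Q)) path_mulZl scale0r. Qed.

Lemma path_mul0r (K : fieldType) (Q : quiver) (x : path_alg K Q) :
  path_mul x 0 = 0.
Proof. by rewrite -{1}(scale0r (0 : path_alg K Q)) path_mulZr scale0r. Qed.

Lemma path_mul_suml (K : fieldType) (Q : quiver) (I : Type) (r : seq I)
    (F : I -> path_alg K Q) (y : path_alg K Q) :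
  path_mul (\sum_(i <- r) F i) y = \sum_(i <- r) path_mul (F i) y.
Proof.
elim: r => [|i r IHr]; first by rewrite !big_nil path_mul0l.
by rewrite !big_cons path_mulDl IHr.
Qed.

Lemma path_mul_sumr (K : fieldType) (Q : quiver) (I : Type) (r : seq I)
    (F : I -> path_alg K Q) (y : path_alg K Q) :
  path_mul y (\sum_(i <- r) F i) = \sum_(i <- r) path_mul y (F i).
Proof.
elim: r => [|i r IHr]; first by rewrite !big_nil path_mul0r.
by rewrite !big_cons path_mulDr IHr.
Qed.

Lemma path_algE (K : fieldType) (Q : quiver) (x : path_alg K Q) :
  x = \sum_(p <- msupp (x : {malg K[qpath Q]})) mcoeff p x *: path_elt K p.
Proof.
rewrite {1}[x]monalgE; apply: eq_bigr => p _; apply/malgP => q.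
rewrite path_elt.unlock; apply: etrans (mcoeffU _ _ _) _.
apply/esym/(etrans (mcoeffZ _ _ _)); rewrite mcoeffU; exact: mulr_natr.
Qed.

Lemma path_mulE (K : fieldType) (Q : quiver) (p q : qpath Q) :
  path_mul (path_elt K p) (path_elt K q) = opath_elt K (qcomp p q).
Proof.
rewrite [path_elt]path_elt.unlock.
rewrite (@path_mulw _ _ _ _ _ _ (@msuppU_le _ _ p 1) (@msuppU_le _ _ q 1)).
by rewrite !big_seq_fset1 !mcoeffUU /= mulr1 scale1r.
Qed.

Lemma path_mul_oeltr (K : fieldType) (Q : quiver) (p : qpath Q) o :
  path_mul (path_elt K p) (opath_elt K o) = opath_elt K (obind (qcomp p) o).
Proof. by case: o => [q|] /=; rewrite ?path_mulE ?path_mul0r. Qed.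

Lemma path_mul_oeltl (K : fieldType) (Q : quiver) (p : qpath Q) o :
  path_mul (opath_elt K o) (path_elt K p)
    = opath_elt K (obind (fun u => qcomp u p) o).
Proof. by case: o => [q|] /=; rewrite ?path_mulE ?path_mul0l. Qed.

Lemma path_mulA (K : fieldType) (Q : quiver) : associative (@path_mul K Q).
Proof.
have A1 (p q : qpath Q) z : path_mul (path_elt K p) (path_mul (path_elt K q) z)
    = path_mul (path_mul (path_elt K p) (path_elt K q)) z.
  rewrite [z]path_algE (path_mul_sumr _ _ (path_elt K q)).
  rewrite (path_mul_sumr _ _ (path_elt K p)).
  rewrite (path_mul_sumr _ _ (path_mul (path_elt K p) (path_elt K q))).
  apply: eq_bigr => r _; rewrite !(@path_mulZr _ _ (mcoeff r z)).
  by rewrite !path_mulE path_mul_oeltr path_mul_oeltl qcompA.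
have A2 (p : qpath Q) y z : path_mul (path_elt K p) (path_mul y z)
    = path_mul (path_mul (path_elt K p) y) z.
  rewrite [y]path_algE (path_mul_suml _ _ z) !(path_mul_sumr _ _ (path_elt K p)).
  rewrite (path_mul_suml _ _ z); apply: eq_bigr => q _.
  apply: etrans (congr1 (path_mul (path_elt K p)) (path_mulZl _ _ _)) _.
  apply: etrans (path_mulZr _ _ _) _; rewrite A1; apply/esym.
  apply: etrans (congr1 (fun u => path_mul u z) (path_mulZr _ _ _)) _.
  exact: path_mulZl.
move=> x y z; rewrite [x]path_algE (path_mul_suml _ _ y).
rewrite (path_mul_suml _ _ (path_mul y z)) (path_mul_suml _ _ z).
apply: eq_bigr => p _.
rewrite (path_mulZl (mcoeff p x) (path_elt K p) (path_mul y z)).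
rewrite (path_mulZl (mcoeff p x) (path_elt K p) y).
by rewrite (path_mulZl (mcoeff p x) (path_mul (path_elt K p) y) z) A2.
Qed.

Lemma path_mul1l (K : fieldType) (Q : quiver) :
  left_id (path_one K Q) (@path_mul K Q).
Proof.
move=> x; rewrite [RHS]path_algE [in LHS](path_algE x).
rewrite (path_mul_sumr _ _ (path_one K Q)).
apply: eq_bigr => p _; rewrite (@path_mulZr _ _ _ (path_one K Q)); congr (_ *: _).
rewrite (path_mul_suml _ _ (path_elt K p)) (bigD1 (qsrc p)) //= path_mulE qcomp_triv eqxx.
rewrite big1 ?addr0 // => v /negbTE ne; by rewrite path_mulE qcomp_triv ne.
Qed.

Lemma path_mul1r (K : fieldType) (Q : quiver) :
  right_id (path_one K Q) (@path_mul K Q).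
Proof.
move=> x; rewrite [RHS]path_algE [in LHS](path_algE x).
rewrite (path_mul_suml _ _ (path_one K Q)).
apply: eq_bigr => p _; rewrite (@path_mulZl _ _ _ _ (path_one K Q)); congr (_ *: _).
rewrite (path_mul_sumr _ _ (path_elt K p)) (bigD1 (qtgt p)) //= path_mulE qcompp_triv eqxx.
rewrite big1 ?addr0 // => v /negbTE ne; rewrite path_mulE qcompp_triv.
by rewrite eq_sym ne.
Qed.

Lemma path_one_neq0 (K : fieldType) (Q : quiver) : path_one K Q != 0.
Proof.
have /card_gt0P[v _] := vertex_gt0 Q.
apply/eqP => /(congr1 (mcoeff (trivial_path v))).
rewrite /path_one path_elt.unlock raddf_sum /= mcoeff0 (bigD1 v) //= mcoeffUU big1 ?addr0; last first.
  move=> w /negbTE ne; rewrite mcoeffU; case: eqP => [|//].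
  by move/(congr1 (@qsrc Q)) => /= /eqP; rewrite /qsrc /= ne.
by move/eqP; rewrite oner_eq0.
Qed.

HB.instance Definition _ (K : fieldType) (Q : quiver) :=
  GRing.Zmodule_isNzRing.Build (path_alg K Q) (@path_mulA K Q)
    (@path_mul1l K Q) (@path_mul1r K Q) (@path_mulDl K Q) (@path_mulDr K Q)
    (@path_one_neq0 K Q).

Lemma path_scalerAl (K : fieldType) (Q : quiver) (c : K) (x y : path_alg K Q) :
  c *: (x * y) = (c *: x) * y.
Proof. by symmetry; apply: path_mulZl. Qed.

HB.instance Definition _ (K : fieldType) (Q : quiver) :=
  GRing.Lmodule_isLalgebra.Build K (path_alg K Q) (@path_scalerAl K Q).

Lemma path_scalerAr (K : fieldType) (Q : quiver) (c : K) (x y : path_alg K Q) :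
  c *: (x * y) = x * (c *: y).
Proof. by symmetry; apply: path_mulZr. Qed.

HB.instance Definition _ (K : fieldType) (Q : quiver) :=
  GRing.Lalgebra_isAlgebra.Build K (path_alg K Q) (@path_scalerAr K Q).

Definition two_sided_ideal (R : nzRingType) (J : R -> Prop) : Prop :=
  [/\ J 0,
      forall x y, J x -> J y -> J (x - y)
    & forall r x, J x -> J (r * x) /\ J (x * r)].

Definition ideal_gen (R : nzRingType) (S : R -> Prop) (x : R) : Prop :=
  forall J : R -> Prop,
    two_sided_ideal J -> (forall y, S y -> J y) -> J x.

Definition ideal_pow (R : nzRingType) (J : R -> Prop) (m : nat) : R -> Prop :=
  ideal_gen (fun y => exists x : 'I_m -> R,
    (forall i, J (x i)) /\ y = \prod_(i < m) x i).

Definition arrow_ideal (K : fieldType) (Q : quiver) : path_alg K Q -> Prop :=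
  ideal_gen (fun x => exists a : arrow Q, x = path_elt K (arrow_path a)).

Definition admissible (K : fieldType) (Q : quiver) (I : path_alg K Q -> Prop) :
    Prop :=
  [/\ two_sided_ideal I,
      exists2 m, (2 <= m)%N & forall x, ideal_pow (@arrow_ideal K Q) m x -> I x
    & forall x, I x -> ideal_pow (@arrow_ideal K Q) 2 x].

Definition zero_relations_ideal (K : fieldType) (Q : quiver)
    (rels : qpath Q -> Prop) : path_alg K Q -> Prop :=
  ideal_gen (fun x => exists2 p, rels p & x = path_elt K p).

(* B is isomorphic to KQ/I, i.e. there is a surjective K-algebra morphism
   KQ -> B with kernel I. *)
Definition quotient_of_path_alg (K : fieldType) (Q : quiver)
    (I : path_alg K Q -> Prop) (B : falgType K) : Prop :=
  exists phi : {lrmorphism path_alg K Q -> B},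
    (forall b, exists x, phi x = b) /\ (forall x, phi x = 0 <-> I x).

Definition monomial_algebra (K : fieldType) (B : falgType K) : Prop :=
  exists (Q : quiver) (rels : qpath Q -> Prop),
    admissible (zero_relations_ideal (K := K) rels)
    /\ quotient_of_path_alg (zero_relations_ideal rels) B.

(* B is not a direct product of two (nonzero) algebras. *)
Definition connected_algebra (K : fieldType) (B : falgType K) : Prop :=
  forall (B1 B2 : falgType K) (f : {lrmorphism B -> B1 * B2}), ~ bijective f.

(* Module theory over a ring R. As usual for finite-dimensional algebras, all
   modules are finitely generated: projectivity and injectivity are those of
   the category of finitely generated modules. *)
Definition fingen (R : nzRingType) (M : lmodType R) : Prop :=
  exists (n : nat) (g : 'I_n -> M),
    forall x, exists c : 'I_n -> R, x = \sum_(i < n) c i *: g i.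

Definition mod_iso (R : nzRingType) (M N : lmodType R) : Prop :=
  exists f : {linear M -> N}, bijective f.

Definition projective (R : nzRingType) (M : lmodType R) : Prop :=
  forall (X Y : lmodType R) (f : {linear X -> Y}) (g : {linear M -> Y}),
    fingen X -> fingen Y -> (forall y, exists x, f x = y) ->
    exists h : {linear M -> X}, forall m, f (h m) = g m.

Definition injective_module (R : nzRingType) (M : lmodType R) : Prop :=
  forall (X Y : lmodType R) (f : {linear X -> Y}) (g : {linear X -> M}),
    fingen X -> fingen Y -> injective f ->
    exists h : {linear Y -> M}, forall x, h (f x) = g x.

Definition zero_module (R : nzRingType) (M : lmodType R) : Prop :=
  forall x : M, x = 0.

Definition indecomposable (R : nzRingType) (M : lmodType R) : Prop :=
  ~ zero_module M /\
  forall X Y : lmodType R,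
    mod_iso M (X * Y)%type -> zero_module X \/ zero_module Y.

Definition submodule (R : nzRingType) (M : lmodType R) (N : M -> Prop) : Prop :=
  N 0 /\ forall (a : R) (x y : M), N x -> N y -> N (a *: x + y).

Definition essential_image (R : nzRingType) (X Y : lmodType R)
    (f : {linear X -> Y}) : Prop :=
  forall N : Y -> Prop, submodule N -> (exists2 y, N y & y != 0) ->
    exists2 x, N (f x) & f x != 0.

Definition exact_at (R : nzRingType) (X Y Z : lmodType R)
    (f : {linear X -> Y}) (g : {linear Y -> Z}) : Prop :=
  forall y, g y = 0 <-> exists x, y = f x.

(* 0 -> M -> I_0 -> I_1 -> ..., with I_0 an injective envelope of M and
   I_(n+1) an injective envelope of the cokernel of the preceding map, which by
   exactness is the image of I_n -> I_(n+1). *)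
Record minimal_injective_coresolution (R : nzRingType) (M : lmodType R)
    (I : nat -> lmodType R) (eps : {linear M -> I 0%N})
    (d : forall n, {linear I n -> I n.+1}) : Prop := {
  coresolution_fingen : forall n, fingen (I n);
  coresolution_inj : forall n, injective_module (I n);
  coresolution_mono : injective eps;
  coresolution_exact0 : exact_at eps (d 0%N);
  coresolution_exactS : forall n, exact_at (d n) (d n.+1);
  coresolution_min0 : essential_image eps;
  coresolution_minS : forall n, essential_image (d n)
}.

(* Extended natural numbers, [None] standing for infinity. *)
Definition enat := option nat.

Definition enat_le (x y : enat) : Prop :=
  match x, y with
  | _, None => True
  | None, Some _ => False
  | Some m, Some n => (m <= n)%N
  end.

Definition enat_sup (S : nat -> Prop) (e : enat) : Prop :=
  (forall m, S m -> enat_le (Some m) e) /\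
  (forall e', (forall m, S m -> enat_le (Some m) e') -> enat_le e e').

(* Number of leading projective terms of a sequence of modules, in the
   form used to define the dominant dimension. *)
Definition leading_projectives (R : nzRingType) (I : nat -> lmodType R)
    (e : enat) : Prop :=
  (~ projective (I 0%N) /\ e = Some 0%N) \/
  (projective (I 0%N) /\
   exists2 t, enat_sup (fun m => forall i, (i <= m)%N -> projective (I i)) t
     & e = omap S t).

(* Right B-modules are left modules over the converse ring B^c: for a right
   module, [b *: x] is x.b. The right regular module is (B^c)^o. *)
Definition right_regular (K : fieldType) (B : falgType K) : lmodType B^c :=
  (B^c)^o.

Definition selfinjective (K : fieldType) (B : falgType K) : Prop :=
  injective_module (right_regular B).

Definition domdim_is (K : fieldType) (B : falgType K) (e : enat) : Prop :=
  exists (I : nat -> lmodType B^c) (eps : {linear right_regular B -> I 0%N})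
    (d : forall n, {linear I n -> I n.+1}),
    minimal_injective_coresolution eps d /\ leading_projectives I e.

Definition indec_proj_inj (R : nzRingType) (M : lmodType R) : Prop :=
  [/\ fingen M, indecomposable M, projective M & injective_module M].

Definition num_indec_proj_inj (K : fieldType) (B : falgType K) (s : nat) : Prop :=
  exists P : 'I_s -> lmodType B^c,
    [/\ forall i, indec_proj_inj (P i),
        forall i j, mod_iso (P i) (P j) -> i = j
      & forall M : lmodType B^c, indec_proj_inj M -> exists i, mod_iso M (P i)].

(* Main.v *)
From HB Require Import structures.
Require Import Defs.
From mathcomp Require Import all_boot all_order all_algebra all_field.
From mathcomp Require Import boolp.
From mathcomp.multinomials Require Import monalg.

(** Follow one uniserial piece of the coresolution [0 -> B -> I_0 -> I_1 -> ...]
    and record the vertices of the simple socles which it meets.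

    Write e_v for the idempotent of the vertex v, and call a nonzero path p
    projective-injective when every nonzero path with the same target is a
    suffix of p, every nonzero path with the same source is a prefix of p, and
    the module e_v B at the source v of p is injective. Then e_v B is uniserial
    with socle spanned by p. A projective term I_k embeds in a free module;
    together with extension of homomorphisms into I_k this forces every vertex
    that supports a simple submodule of I_k to be the target of a
    projective-injective path ([socle_proj_inj_path]). Applied to I_0 and I_1,
    this shows that at most one nonzero arrow leaves each vertex
    ([arrow_out_unique]), so every e_v B is uniserial.

    As B is not selfinjective, some e_i B is not injective. Its image in I_0 is
    generated by an element xi_0, and it is the uniserial module of the longest
    nonzero path w_0 from i. Let x_0 be the target of w_0, and p_0 = q_0 w_0 the
    projective-injective path ending at x_0. Choose b in I_0 with b q_0 = xi_0
    and write q_0 = w_1 a with a an arrow: the image of b in I_1 generates the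
    uniserial module of w_1, whose socle sits at the source x_1 of a. The
    construction repeats as long as the terms are projective ([segment_step],
    [segment_extend]). It yields vertices x_0, x_1, x_2, ... and paths p_k ending
    at x_k, with an arrow from x_1 to i and, for k >= 2, an arrow from x_k to the
    source of p_(k-2).

    Since the arrow leaving a vertex is unique, x_a = x_b with a, b >= 2 implies
    x_(a-2) = x_(b-2); and x_1 = x_b with b >= 2 is impossible, because it would
    identify e_i B with the injective module at the source of p_(b-2). Hence x_a
    with a odd differs from every later x_b ([odd_socles_distinct]). If the
    terms I_0, ..., I_2s were all projective, the s + 1 vertices
    x_1, x_3, ..., x_(2s-1), x_2s would be distinct, and the corresponding e_v B
    would be s + 1 pairwise nonisomorphic indecomposable projective-injective
    modules. *)

Set Implicit Arguments.
Unset Strict Implicit.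
Unset Printing Implicit Defensive.

Import GRing.Theory.
Local Open Scope ring_scope.

(** * Modules over a ring *)

(** Packs a function that is linear in the logical sense; this is how all
    homomorphisms defined inside proofs are built. *)
Lemma linear_of (R : nzRingType) (U V : lmodType R) (f : U -> V) :
  linear f -> exists g : {linear U -> V}, g =1 f.
Proof.
move=> fl.
pose M := GRing.isLinear.Build R U V _ f fl.
pose g : {linear U -> V} := HB.pack f M.
by exists g.
Qed.

Lemma mod_iso_sym (R : nzRingType) (M N : lmodType R) : mod_iso M N -> mod_iso N M.
Proof.
move=> [f [g fK gK]].
have [h hE] : exists h : {linear N -> M}, h =1 g.
  by apply: linear_of => a x y; apply: (can_inj fK); rewrite linearP !gK.
by exists h; exists f => x; rewrite hE.
Qed.

Lemma mod_iso_trans (R : nzRingType) (M N L : lmodType R) :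
  mod_iso M N -> mod_iso N L -> mod_iso M L.
Proof.
move=> [f fb] [g gb].
have [h hE] : exists h : {linear M -> L}, h =1 g \o f.
  by apply: linear_of => a x y; rewrite /= !linearP.
by exists h; apply: eq_bij (bij_comp gb fb) _ _ => x; rewrite hE.
Qed.

Section Submodule.
Variables (R : nzRingType) (M : lmodType R) (N : M -> Prop).

(** Membership is an arbitrary proposition, so it is reflected into a classical
    boolean in order to obtain a subtype carrying a module structure. *)
Record submod (sN : submodule N) := Submod {
  submod_val : M;
  submod_mem : `[<N submod_val>]
}.

Variable (sN : submodule N).
HB.instance Definition _ := [isSub of submod sN for @submod_val sN].
HB.instance Definition _ := [Choice of submod sN by <:].

Fact submod_closed_subproof : submod_closed (fun x : M => `[<N x>]).
Proof.
have [N0 NZ] := sN; split; first by apply/asboolP.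
by move=> a x y /asboolP Nx /asboolP Ny; apply/asboolP/NZ.
Qed.

HB.instance Definition _ := GRing.SubChoice_isSubLmodule.Build R M
  (fun x : M => `[<N x>]) (submod sN)
  (GRing.submod_closed_semi submod_closed_subproof).

Definition submod_of x (Nx : N x) : submod sN := Submod sN (asboolT Nx).

Lemma submodP (x : submod sN) : N (val x).
Proof. exact/asboolP/(submod_mem x). Qed.

Lemma submod_val_lin a (x y : submod sN) :
  val (a *: x + y) = a *: val x + val y.
Proof. by []. Qed.

Lemma submod_valZ a (x : submod sN) : val (a *: x) = a *: val x.
Proof. by []. Qed.

End Submodule.

Lemma fingen_regular (R : nzRingType) : fingen (R^o : lmodType R).
Proof.
exists 1%N, (fun _ => 1) => x; exists (fun _ => x).
by rewrite big_ord_recl big_ord0 addr0 /GRing.scale /= mulr1.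
Qed.

(** One half of Baer's criterion, for the ideal generated by the [g i]: the
    hypothesis says that sending [g i] to [m i] is a well-defined homomorphism,
    and every homomorphism from [R] is evaluation on an element. *)
Lemma injective_extend (R : nzRingType) (M : lmodType R) (I : finType)
    (g : I -> R) (m : I -> M) :
  injective_module M ->
  (forall c : I -> R, \sum_i c i * g i = 0 -> \sum_i c i *: m i = 0) ->
  exists y : M, forall i, g i *: y = m i.
Proof.
move=> injM gm.
pose N (x : R^o) := exists c : I -> R, x = \sum_i c i * g i.
have sN : submodule N.
  split; first by exists (fun=> 0); rewrite big1 // => i _; rewrite mul0r.
  move=> a x y [c ->] [c' ->]; exists (fun i => a * c i + c' i).
  rewrite scaler_sumr -big_split; apply: eq_bigr => i _.
  by rewrite /= /GRing.scale /= mulrDl mulrA.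
have Ng i : N (g i).
  exists (fun j => (j == i)%:R); rewrite (bigD1 i) //= eqxx mul1r.
  by rewrite big1 ?addr0 // => j /negbTE->; rewrite mul0r.
have cP (x : submod sN) : {c : I -> R | val x = \sum_i c i * g i}.
  exact: cid (submodP x).
pose h x := \sum_i sval (cP x) i *: m i.
have hE (x : submod sN) c : val x = \sum_i c i * g i -> h x = \sum_i c i *: m i.
  rewrite /h; case: (cP x) => c' /= -> /eqP; rewrite -subr_eq0 -sumrB => /eqP e.
  apply/eqP; rewrite -subr_eq0 -sumrB; apply/eqP.
  rewrite -[RHS](gm (fun i => c' i - c i)).
    by apply: eq_bigr => i _; rewrite scalerBl.
  by rewrite -[RHS]e; apply: eq_bigr => i _; rewrite mulrBl.
have [hl hlE] : exists hl : {linear submod sN -> M}, hl =1 h.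
  apply: linear_of => a x y; rewrite (hE _ (fun i => a * sval (cP x) i + sval (cP y) i)).
    rewrite /h scaler_sumr -big_split; apply: eq_bigr => i _.
    by rewrite /= scalerDl scalerA.
  transitivity (a *: (\sum_i sval (cP x) i * g i : R^o) + \sum_i sval (cP y) i * g i).
    by rewrite linearP -(svalP (cP x)) -(svalP (cP y)).
  rewrite scaler_sumr -big_split.
  by apply: eq_bigr => i _; rewrite /= /GRing.scale /= mulrDl mulrA.
pose f : {linear submod sN -> R^o} := (val : submod sN -> R^o).
have [||F FE] := injM _ _ f hl _ _ (@val_inj _ _ _).
- exists #|I|, (fun k => submod_of sN (Ng (enum_val k))) => x.
  exists (fun k => sval (cP x) (enum_val k)); apply: val_inj.
  transitivity (\sum_i sval (cP x) i * g i); first exact: svalP (cP x).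
  rewrite raddf_sum /= (reindex _ (onW_bij _ (@enum_val_bij I))) /=.
  by apply: eq_bigr => i _.
- exact: fingen_regular.
exists (F 1) => i; rewrite -linearZ /= [_ *: _]mulr1.
rewrite -[g i]/(f (submod_of sN (Ng i))) FE hlE.
rewrite (hE _ (fun j => (j == i)%:R)).
  rewrite (bigD1 i) //= eqxx scale1r big1 ?addr0 // => j /negbTE->.
  by rewrite scale0r.
rewrite /= (bigD1 i) //= eqxx mul1r big1 ?addr0 // => j /negbTE->.
by rewrite mul0r.
Qed.

(** A finitely generated projective module is a direct summand of a free module,
    so some coordinate of [m] is nonzero. *)
Lemma projective_torsionless (R : nzRingType) (M : lmodType R) (m : M) :
  projective M -> fingen M -> m != 0 -> exists f : {linear M -> R^o}, f m != 0.
Proof.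
move=> prM [n [g gP]] m0.
pose X : lmodType R := {ffun 'I_n -> R^o}.
have [pi piE] : exists pi : {linear X -> M}, forall v, pi v = \sum_i (v i : R) *: g i.
  apply: linear_of => a x y; rewrite scaler_sumr -big_split; apply: eq_bigr => i _.
  by rewrite /= !ffunE scalerDl scalerA.
have fgX : fingen X.
  exists n, (fun i => [ffun j => (i == j)%:R]) => v; exists v.
  apply/ffunP => j; rewrite sum_ffunE (bigD1 j) //= !ffunE eqxx [_ *: _]mulr1.
  by rewrite big1 ?addr0 // => i /negbTE ne; rewrite !ffunE ne scaler0.
have fgM : fingen M by exists n, g.
have [//|h hE] := prM X M pi idfun fgX fgM.
  by move=> y; have [c ->] := gP y; exists (finfun c); rewrite piE;
    apply: eq_bigr => i _; rewrite ffunE.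
have [i hi] : exists i, h m i != 0.
  apply: contrapT => nex; case/eqP: m0; rewrite -[LHS]/(idfun m) -hE piE big1 // => i _.
  by case: (eqVneq (h m i) 0) => [->|ne]; [rewrite scale0r | case: nex; exists i].
have [f fE] : exists f : {linear M -> R^o}, f =1 (fun x => h x i).
  by apply: linear_of => a x y; rewrite linearP !ffunE.
by exists f; rewrite fE.
Qed.

(** * Paths and the path algebra *)

Section Paths.
Variable Q : quiver.
Implicit Types p q r : qpath Q.

Lemma qpath_eq p q : qsrc p = qsrc q -> qword p = qword q -> p = q.
Proof.
move=> e1 e2; apply: qpath_val_inj.
by rewrite [LHS]surjective_pairing [RHS]surjective_pairing; congr pair.
Qed.

Lemma qcompE p q r : qcomp p q = Some r <->
  [/\ qtgt p = qsrc q, qsrc r = qsrc p & qword r = qword p ++ qword q].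
Proof.
have := qcompP p q; case: eqP => [e [r' -> vr']|ne ->]; last by split=> // -[].
split=> [[<-]|[_ er wr]]; first by rewrite /qsrc /qword vr'.
by congr Some; apply: qpath_eq; rewrite ?er ?wr /qsrc /qword vr'.
Qed.

Lemma qtgt_comp p q r : qcomp p q = Some r -> qtgt r = qtgt q.
Proof.
by case/qcompE=> e er wr; rewrite /qtgt er wr walk_end_cat -/(qtgt p) e.
Qed.

Lemma qpath_cat r s t : qword r = s ++ t ->
  exists p q, [/\ qcomp p q = Some r, qword p = s & qword q = t].
Proof.
move=> e; have := qpath_walk r; rewrite -/(qsrc r) -/(qword r) e walk_cat.
case/andP=> ws wt.
exists (@QPath Q (qsrc r, s) ws), (@QPath Q (walk_end (qsrc r) s, t) wt).
by split=> //; apply/qcompE.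
Qed.

Definition is_prefix p r := exists q, qcomp p q = Some r.
Definition is_suffix q r := exists p, qcomp p q = Some r.

Lemma is_prefixE p r : is_prefix p r <-> qsrc p = qsrc r /\ prefix (qword p) (qword r).
Proof.
split=> [[q /qcompE[_ -> ->]]|[e /prefixP[t er]]].
  by rewrite prefix_prefix.
have [p' [q [c wp wq]]] := qpath_cat er; exists q.
by rewrite (_ : p = p') //; apply: qpath_eq => //; case/qcompE: c => _ <-.
Qed.

Lemma is_prefix_refl p : is_prefix p p.
Proof. by apply/is_prefixE; rewrite prefix_refl. Qed.

Lemma is_prefix_comparable p q r : is_prefix p r -> is_prefix q r -> is_prefix p q \/ is_prefix q p.
Proof.
case/is_prefixE=> ep wp; case/is_prefixE=> eq wq.
case/orP: (leq_total (size (qword p)) (size (qword q))) => le; [left|right];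
  apply/is_prefixE; rewrite ep eq; split=> //.
- rewrite prefixE; move: wp wq; rewrite !prefixE => /eqP wp /eqP <-.
  by rewrite take_takel // wp.
- rewrite prefixE; move: wp wq; rewrite !prefixE => /eqP <- /eqP wq.
  by rewrite take_takel // wq.
Qed.

Lemma is_prefix_trans q p r : is_prefix p q -> is_prefix q r -> is_prefix p r.
Proof.
case/is_prefixE=> ep wp; case/is_prefixE=> eq wq; apply/is_prefixE; rewrite ep eq; split=> //.
exact: prefix_trans wp wq.
Qed.

Lemma is_prefix_size p r : is_prefix p r -> (size (qword p) <= size (qword r))%N.
Proof. by case/is_prefixE=> _ /size_prefix. Qed.

Lemma is_prefix_antisym p r : is_prefix p r -> (size (qword r) <= size (qword p))%N -> p = r.
Proof.
case/is_prefixE=> e /prefixP[t w] le; apply: qpath_eq => //; rewrite w.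
move: le; rewrite w size_cat -{2}[size (qword p)]addn0 leq_add2l leqn0 size_eq0.
by move/eqP->; rewrite cats0.
Qed.

Lemma is_suffix_size p r : is_suffix p r -> (size (qword p) <= size (qword r))%N.
Proof. by case=> q /qcompE[_ _ ->]; rewrite size_cat leq_addl. Qed.

Lemma is_suffix_tgt p r : is_suffix p r -> qtgt p = qtgt r.
Proof. by case=> q /qtgt_comp. Qed.

(** The words alone do not suffice: a trivial path is a suffix only at the right
    vertex, which is why the targets are tracked through the common path. *)
Lemma is_suffix_comparable p q r : is_suffix p r -> is_suffix q r ->
  (size (qword p) <= size (qword q))%N -> is_suffix p q.
Proof.
case=> u /qcompE[tu eu wu] [v /qcompE[tv ev wv]] le.
have e : qword v ++ qword q = qword u ++ qword p by rewrite -wu.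
have lev : (size (qword v) <= size (qword u))%N.
  by have := congr1 size e; rewrite !size_cat => e';
    rewrite -(leq_add2r (size (qword p))) -e' leq_add2l.
have := congr1 (take (size (qword v))) e; rewrite take_size_cat // takel_cat // => e1.
have wq : qword q = drop (size (qword v)) (qword u) ++ qword p.
  have := congr1 (drop (size (qword v))) e; rewrite drop_size_cat // => ->.
  rewrite drop_cat; case: ltnP => // ge.
  by rewrite [X in _ = X ++ _]drop_oversize // (eqnP lev) drop0.
have [p1 [p2 [c w1 w2]]] := qpath_cat wq.
exists p1; rewrite (_ : p = p2) //; apply: qpath_eq => //.
have [<- e1s _] := iffLR (qcompE _ _ _) c.
rewrite -tu /qtgt w1 -e1s -tv /qtgt -ev eu -{1}(cat_take_drop (size (qword v)) (qword u)) -e1.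
by rewrite walk_end_cat.
Qed.

Lemma qpath_cons p a s : qword p = a :: s ->
  exists p', qcomp (arrow_path a) p' = Some p /\ qword p' = s.
Proof.
move=> wp; have [p1 [p2 [c w1 w2]]] := @qpath_cat p [:: a] s wp.
exists p2; split=> //; rewrite -(_ : p1 = arrow_path a) //.
apply: qpath_eq; rewrite ?w1 //.
have := qpath_walk p1; rewrite -/(qsrc p1) -/(qword p1) w1 /= andbT.
by move/eqP.
Qed.

End Paths.

Section PathAlgebra.
Variables (K : fieldType) (Q : quiver).
Notation elt := (path_elt K).
Implicit Types (x : path_alg K Q) (p q r : qpath Q).

Lemma path_alg_ind (P : path_alg K Q -> Prop) :
  P 0 -> (forall x y, P x -> P y -> P (x + y)) ->
  (forall c p, P (c *: elt p)) -> forall x, P x.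
Proof.
by move=> P0 PD PZ x; rewrite [x]path_algE; apply: big_ind.
Qed.

Lemma path_eltM p q : elt p * elt q = opath_elt K (qcomp p q).
Proof. exact: path_mulE. Qed.

Lemma mcoeff_pathD r x y : mcoeff r (x + y) = mcoeff r x + mcoeff r y.
Proof. exact: mcoeffD. Qed.
Lemma mcoeff_pathB r x y : mcoeff r (x - y) = mcoeff r x - mcoeff r y.
Proof. exact: mcoeffB. Qed.
Lemma mcoeff_pathZ r c x : mcoeff r (c *: x) = c * mcoeff r x.
Proof. exact: mcoeffZ. Qed.
Lemma mcoeff_path0 r : mcoeff r (0 : path_alg K Q) = 0.
Proof. exact: mcoeff0. Qed.
Lemma mcoeff_elt r p : mcoeff r (elt p) = (p == r)%:R.
Proof. by rewrite path_elt.unlock mcoeffU. Qed.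

Lemma mcoeff_oelt r o : mcoeff r (opath_elt K o) = (o == Some r)%:R.
Proof. by case: o => [p|]; rewrite ?mcoeff_elt ?mcoeff_path0. Qed.

(** Concatenation of paths is cancellative, hence at most one path of [x]
    contributes to the coefficient of [r]. *)
Lemma mcoeff_mull q p r x : qcomp q p = Some r ->
  mcoeff r (elt q * x) = mcoeff p x.
Proof.
move=> c; elim/path_alg_ind: x => [|x y IHx IHy|a p'].
- by rewrite mulr0 !mcoeff_path0.
- by rewrite mulrDr !mcoeff_pathD IHx IHy.
rewrite -scalerAr !mcoeff_pathZ path_eltM mcoeff_oelt mcoeff_elt; congr (_ * _%:R).
case: (p' =P p) => [->|ne]; rewrite ?c ?eqxx //.
case: eqP => // c'; case: ne; case/qcompE: c => t es w; case/qcompE: c' => t' es' w'.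
apply: qpath_eq; first by rewrite -t.
by move: w'; rewrite w => /eqP; rewrite eqseq_cat // eqxx /= => /eqP.
Qed.

Lemma mcoeff_mulr q p r x : qcomp p q = Some r ->
  mcoeff r (x * elt q) = mcoeff p x.
Proof.
move=> c; elim/path_alg_ind: x => [|x y IHx IHy|a p'].
- by rewrite mul0r !mcoeff_path0.
- by rewrite mulrDl !mcoeff_pathD IHx IHy.
rewrite -scalerAl !mcoeff_pathZ path_eltM mcoeff_oelt mcoeff_elt; congr (_ * _%:R).
case: (p' =P p) => [->|ne]; rewrite ?c ?eqxx //.
case: eqP => // c'; case: ne; case/qcompE: c => t es w; case/qcompE: c' => t' es' w'.
apply: qpath_eq; first by rewrite -es.
have e : qword p ++ qword q = qword p' ++ qword q by rewrite -w'.
have := congr1 size e; rewrite !size_cat => /addIn sz.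
by move/eqP: e; rewrite eqseq_cat // => /andP[/eqP].
Qed.

Lemma mcoeff_mull0 q r x : (forall p, qcomp q p <> Some r) ->
  mcoeff r (elt q * x) = 0.
Proof.
move=> c; elim/path_alg_ind: x => [|x y IHx IHy|a p'].
- by rewrite mulr0 !mcoeff_path0.
- by rewrite mulrDr !mcoeff_pathD IHx IHy addr0.
rewrite -scalerAr !mcoeff_pathZ path_eltM mcoeff_oelt.
by case: eqP => [/c|]; rewrite ?mulr0.
Qed.

Lemma mcoeff_mulr0 q r x : (forall p, qcomp p q <> Some r) ->
  mcoeff r (x * elt q) = 0.
Proof.
move=> c; elim/path_alg_ind: x => [|x y IHx IHy|a p'].
- by rewrite mul0r !mcoeff_path0.
- by rewrite mulrDl !mcoeff_pathD IHx IHy addr0.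
rewrite -scalerAl !mcoeff_pathZ path_eltM mcoeff_oelt.
by case: eqP => [/c|]; rewrite ?mulr0.
Qed.

End PathAlgebra.

Lemma path_elt_prod (K : fieldType) (Q : quiver) (p : qpath Q) :
  path_elt K p = path_elt K (trivial_path (qsrc p)) *
    \prod_(a <- qword p) path_elt K (arrow_path a).
Proof.
move: {2}(qword p) (erefl (qword p)) => s; elim: s p => [|a s IHs] p wp.
  by rewrite wp big_nil mulr1; congr path_elt; apply: qpath_eq.
have [p' [c wp']] := qpath_cons wp.
have [tp sp _] := iffLR (qcompE _ _ _) c.
have e : path_elt K p = path_elt K (arrow_path a) * path_elt K p'.
  by rewrite path_eltM c.
rewrite wp big_cons -wp' mulrA path_eltM qcomp_triv sp eqxx /=.
by rewrite e {1}(IHs _ wp') mulrA path_eltM -tp qcompp_triv eqxx.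
Qed.

(** A path of length at least [m] is a product of [m] arrows followed by a path,
    so it lies in the power of the arrow ideal that admissibility provides. *)
Lemma long_paths_vanish (K : fieldType) (Q : quiver) (rels : qpath Q -> Prop) :
  admissible (zero_relations_ideal (K := K) rels) ->
  exists m, forall p : qpath Q, (m <= size (qword p))%N ->
    zero_relations_ideal rels (path_elt K p).
Proof.
move=> [_ [m _ mI] _]; exists m => p le; apply: mI => J JJ HJ.
have [p1 [p2 [c w1 _]]] := qpath_cat (esym (cat_take_drop m (qword p))).
have -> : path_elt K p = path_elt K p1 * path_elt K p2 by rewrite path_eltM c.
have [_ _ JM] := JJ; apply: (JM _ _ _).2; rewrite path_elt_prod; apply: (JM _ _ _).1.
apply: HJ; rewrite w1.
have sz : size (take m (qword p)) == m by rewrite size_takel.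
exists (fun i => path_elt K (arrow_path (tnth (Tuple sz) i))); split.
  by move=> i J' _; apply; exists (tnth (Tuple sz) i).
by rewrite -(big_tuple _ _ (Tuple sz) xpredT (fun a => path_elt K (arrow_path a))).
Qed.

(** * Right modules over a finite-dimensional algebra *)

(** Injective endomorphisms of a finite-dimensional space are bijective. *)
Lemma mull_inj_inv (K : fieldType) (B : falgType K) (u : B) :
  (forall b, u * b = 0 -> b = 0) -> exists v, u * v = 1 /\ v * u = 1.
Proof.
move=> u_inj.
have ker0 : lker (amull u) == 0%VS.
  apply/lker0P => x y; rewrite !lfunE /= => /eqP; rewrite -subr_eq0 -mulrBr.
  by move=> /eqP/u_inj/eqP; rewrite subr_eq0 => /eqP.
pose v := (amull u)^-1%VF 1; exists v.
have uv : u * v = 1 by have := lker0_lfunVK ker0 1; rewrite !lfunE.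
split=> //; apply/eqP; rewrite -subr_eq0; apply/eqP/u_inj.
by rewrite mulrBr mulrA uv mul1r mulr1 subrr.
Qed.

Section Action.
Variables (K : fieldType) (B : falgType K).

Definition act (M : lmodType B^c) (m : M) (b : B) : M := (b : B^c) *: m.
Local Notation "m |> b" := (act m b) (at level 40, left associativity).

Variables (M N : lmodType B^c).
Implicit Types (m : M) (a b : B).

Lemma actM m a b : m |> a |> b = m |> (a * b).
Proof. by rewrite /act scalerA. Qed.
Lemma actDr m a b : m |> (a + b) = m |> a + m |> b.
Proof. by rewrite /act; apply: (@scalerDl B^c). Qed.
Lemma act0r m : m |> 0 = 0.
Proof. by rewrite /act; apply: (@scale0r B^c). Qed.
Lemma actBl m m' b : (m - m') |> b = m |> b - m' |> b.
Proof. by rewrite /act scalerBr. Qed.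
Lemma act0l b : (0 : M) |> b = 0.
Proof. by rewrite /act scaler0. Qed.
Lemma linear_act (f : {linear M -> N}) m b : f (m |> b) = f m |> b.
Proof. by rewrite /act linearZ. Qed.
Lemma act_regular (x : B) b : (x : right_regular B) |> b = x * b.
Proof. by []. Qed.

Lemma act_extend (I : finType) (g : I -> B) (m : I -> M) :
  injective_module M ->
  (forall c : I -> B, \sum_i g i * c i = 0 -> \sum_i m i |> c i = 0) ->
  exists y : M, forall i, y |> g i = m i.
Proof. by move=> injM H; apply: (@injective_extend B^c). Qed.

Lemma act_extend1 (g : B) (m : M) : injective_module M ->
  (forall c : B, g * c = 0 -> m |> c = 0) -> exists y : M, y |> g = m.
Proof.
move=> injM H; have [|y yP] := @act_extend unit (fun=> g) (fun=> m) injM.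
  by move=> c; rewrite !(big_pred1 tt) => [/H|[]|[]].
by exists y; apply: yP tt.
Qed.

Lemma act_extend2 (g h : B) (m n : M) : injective_module M ->
  (forall c d : B, g * c + h * d = 0 -> m |> c + n |> d = 0) ->
  exists y : M, y |> g = m /\ y |> h = n.
Proof.
move=> injM H.
have [|y yP] := @act_extend bool (fun i => if i then g else h) (fun i => if i then m else n) injM.
  by move=> c; rewrite !big_bool; apply: H.
by exists y; split; [apply: yP true | apply: yP false].
Qed.

End Action.
Notation "m |> b" := (act m b) (at level 40, left associativity).

(** * The basis of nonzero paths *)

Section MonomialAlgebra.
Variables (K : fieldType) (B : falgType K) (Q : quiver).
Variables (rels : qpath Q -> Prop) (phi : {lrmorphism path_alg K Q -> B}).
Hypothesis phi_surj : forall b, exists x, phi x = b.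
Hypothesis phi_ker : forall x, phi x = 0 <-> zero_relations_ideal rels x.

Implicit Types (p q r : qpath Q) (b : B).

Definition bpath p : B := phi (path_elt K p).
Definition nonzero p : bool := bpath p != 0.
Definition videm v : B := bpath (trivial_path v).
Definition barrow a : B := bpath (arrow_path a).

Lemma bpathM p q : bpath p * bpath q = oapp bpath 0 (qcomp p q).
Proof.
rewrite /bpath -rmorphM path_eltM; case: (qcomp p q) => //=; exact: rmorph0.
Qed.

Lemma bpath_comp p q r : qcomp p q = Some r -> bpath p * bpath q = bpath r.
Proof. by rewrite bpathM => ->. Qed.

Lemma nonzero_comp p q r : qcomp p q = Some r -> nonzero r -> nonzero p /\ nonzero q.
Proof.
move=> /bpath_comp e; rewrite /nonzero -e => n0.
by split; apply: contraNneq n0 => ->; rewrite ?mulr0 ?mul0r.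
Qed.

Lemma videm_bpath v p : videm v * bpath p = if v == qsrc p then bpath p else 0.
Proof. by rewrite bpathM qcomp_triv; case: eqP. Qed.

Lemma bpath_videm v p : bpath p * videm v = if qtgt p == v then bpath p else 0.
Proof. by rewrite bpathM qcompp_triv; case: eqP. Qed.

Lemma sum_videm : \sum_v videm v = 1.
Proof. by rewrite -(rmorph1 phi) -raddf_sum. Qed.

(** The ideal generated by paths is spanned by paths: the elements whose
    support consists of paths that vanish in [B] form a two-sided ideal containing
    the relations. This is where the monomial hypothesis enters, and it makes the
    nonzero paths a basis of [B]. *)
Lemma ker_supp x p : phi x = 0 -> mcoeff p x != 0 -> bpath p = 0.
Proof.
pose J (y : path_alg K Q) := forall p, mcoeff p y != 0 -> bpath p = 0.
have J0 : J 0 by move=> q; rewrite mcoeff_path0 eqxx.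
have JD y z : J y -> J z -> J (y + z).
  move=> Jy Jz q; rewrite mcoeff_pathD; case: (eqVneq (mcoeff q y) 0) => [->|/Jy //].
  by rewrite add0r => /Jz.
have JZ c y : J y -> J (c *: y).
  by move=> Jy q; rewrite mcoeff_pathZ mulf_eq0 => /norP[_ /Jy].
suff JJ : two_sided_ideal J.
  move=> /phi_ker Ix; move: p; apply: (Ix J JJ) => y [q rq ->] p.
  rewrite mcoeff_elt; case: (q =P p) => [<- _|_]; rewrite ?eqxx //.
  by apply/phi_ker => J' JJ' HJ'; apply: HJ'; exists q.
split=> //; first by move=> y z Jy Jz; rewrite -scaleN1r; apply/JD/JZ.
move=> y z Jz; split.
  elim/path_alg_ind: y => [|y y' IH IH'|c q]; rewrite ?mul0r ?mulrDl //; first exact: JD.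
  rewrite -scalerAl; apply: JZ => r; case: (pselect (exists p, qcomp q p = Some r)).
    by case=> p' c'; rewrite (mcoeff_mull _ c') -(bpath_comp c') => /Jz->; rewrite mulr0.
  by move=> ne; rewrite mcoeff_mull0 ?eqxx // => p' c'; case: ne; exists p'.
elim/path_alg_ind: y => [|y y' IH IH'|c q]; rewrite ?mulr0 ?mulrDr //; first exact: JD.
rewrite -scalerAr; apply: JZ => r; case: (pselect (exists p, qcomp p q = Some r)).
  by case=> p' c'; rewrite (mcoeff_mulr _ c') -(bpath_comp c') => /Jz->; rewrite mul0r.
by move=> ne; rewrite mcoeff_mulr0 ?eqxx // => p' c'; case: ne; exists p'.
Qed.

(** The coefficient of [b] on a nonzero path, read off on any preimage of [b] in
    the path algebra; [ker_supp] makes the choice irrelevant. *)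
Definition pcoef b p : K :=
  if nonzero p then mcoeff p (sval (cid (phi_surj b))) else 0.

Lemma pcoef_phi x p : nonzero p -> pcoef (phi x) p = mcoeff p x.
Proof.
move=> np; rewrite /pcoef np; case: cid => y /= e; apply/eqP; rewrite -subr_eq0.
rewrite -mcoeff_pathB; apply: contraNT np => /ker_supp->//.
have -> : phi (y - x) = phi y - phi x by exact: rmorphB.
  by rewrite e subrr.
Qed.

Lemma pcoef_nonzero b p : pcoef b p != 0 -> nonzero p.
Proof. by rewrite /pcoef; case: ifP; rewrite ?eqxx. Qed.

Lemma pcoef0 p : pcoef 0 p = 0.
Proof.
case: (boolP (nonzero p)) => [np|/negbTE np]; last by rewrite /pcoef np.
by rewrite -(raddf0 phi) pcoef_phi // mcoeff_path0.
Qed.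

Lemma pcoefD a b p : pcoef (a + b) p = pcoef a p + pcoef b p.
Proof.
have [x <-] := phi_surj a; have [y <-] := phi_surj b.
case: (boolP (nonzero p)) => [np|/negbTE np]; last by rewrite /pcoef np addr0.
by rewrite -raddfD !pcoef_phi // mcoeff_pathD.
Qed.

Lemma pcoef_sum (I : finType) (F : I -> B) p :
  pcoef (\sum_i F i) p = \sum_i pcoef (F i) p.
Proof. by apply: (big_morph (pcoef^~ p)) => [a b|]; [exact: pcoefD | exact: pcoef0]. Qed.

Lemma pcoef_bpath p r : nonzero r -> pcoef (bpath p) r = (p == r)%:R.
Proof. by move=> nr; rewrite pcoef_phi // mcoeff_elt. Qed.

Lemma pcoef_mull q p r b : qcomp q p = Some r -> nonzero r ->
  pcoef (bpath q * b) r = pcoef b p.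
Proof.
move=> c nr; have [x <-] := phi_surj b; have [_ np] := nonzero_comp c nr.
by rewrite -rmorphM !pcoef_phi // (mcoeff_mull _ c).
Qed.

Lemma pcoef_mulr q p r b : qcomp p q = Some r -> nonzero r ->
  pcoef (b * bpath q) r = pcoef b p.
Proof.
move=> c nr; have [x <-] := phi_surj b; have [np _] := nonzero_comp c nr.
by rewrite -rmorphM !pcoef_phi // (mcoeff_mulr _ c).
Qed.

Lemma pcoef_mull_prefix q r b : pcoef (bpath q * b) r != 0 -> is_prefix q r.
Proof.
move=> n0; have nr := pcoef_nonzero n0; apply: contrapT => ne; case/eqP: n0.
have [x <-] := phi_surj b; rewrite -rmorphM pcoef_phi // mcoeff_mull0 // => p c.
by case: ne; exists p.
Qed.

Lemma pcoef_mulr_suffix q r b : pcoef (b * bpath q) r != 0 -> is_suffix q r.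
Proof.
move=> n0; have nr := pcoef_nonzero n0; apply: contrapT => ne; case/eqP: n0.
have [x <-] := phi_surj b; rewrite -rmorphM pcoef_phi // mcoeff_mulr0 // => p c.
by case: ne; exists p.
Qed.

(** It suffices to test on paths, as [b] is a combination of the paths on which
    its coefficient is nonzero. *)
Lemma act_eq0 (M : lmodType B^c) (m : M) b :
  (forall p, pcoef b p != 0 -> m |> bpath p = 0) -> m |> b = 0.
Proof.
have [x <-] := phi_surj b => H.
rewrite [x]path_algE raddf_sum /=.
have aD u v : m |> (u + v) = m |> u + m |> v by apply: actDr.
rewrite (big_morph _ aD (act0r m)) big1 // => p _.
rewrite linearZ /= -/(bpath p) -[bpath p]mulr1 scalerAr -actM.
case: (boolP (nonzero p)) => [np|]; last by rewrite negbK => /eqP->; rewrite act0r act0l.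
case: (eqVneq (mcoeff p x) 0) => [->|n0]; first by rewrite scale0r act0r.
by rewrite H ?act0l // pcoef_phi.
Qed.

Lemma pcoef_eq0 b : (forall p, pcoef b p = 0) -> b = 0.
Proof.
move=> H; rewrite -[b]mul1r -act_regular act_eq0 // => p.
by rewrite H eqxx.
Qed.

Lemma pcoef_neq0 b : b != 0 -> exists p, pcoef b p != 0.
Proof.
move=> b0; apply: contrapT => ne; case/eqP: b0; apply: pcoef_eq0 => p.
by apply/eqP/negPn/negP => n0; case: ne; exists p.
Qed.

Definition vproj_pred v (b : right_regular B) : Prop := videm v * b = b.

Lemma vproj_sub v : submodule (@vproj_pred v).
Proof.
rewrite /vproj_pred; split; first exact: mulr0.
move=> a x y ex ey; rewrite -[a *: x]/(x |> a) act_regular.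
by rewrite mulrDr ey mulrA ex.
Qed.

Lemma videm_idem v : videm v * videm v = videm v.
Proof. by rewrite videm_bpath eqxx. Qed.

(** The right module e_v B. *)
Definition vproj v : lmodType B^c := submod (vproj_sub v).

Definition vproj_of v b : vproj v :=
  @submod_of _ _ (@vproj_pred v) (vproj_sub v) (videm v * b)
    (etrans (mulrA _ _ _) (congr1 ( *%R^~ b) (videm_idem v))).

Lemma val_vproj_act v (x : vproj v) b : val (x |> b) = (val x : B) * b.
Proof. exact: (@submod_valZ B^c _ _ (vproj_sub v) b x). Qed.

Lemma val_vproj_lin v (a : B) (x y : vproj v) :
  val ((a : B^c) *: x + y) = (val x : B) * a + val y :> B.
Proof. exact: (@submod_val_lin B^c _ _ (vproj_sub v) a x y). Qed.

Lemma vprojP v (x : vproj v) : videm v * val x = val x.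
Proof. exact: submodP x. Qed.

Lemma vproj_ofE v (x : vproj v) : x = vproj_of v 1 |> val x.
Proof. by apply: val_inj; rewrite val_vproj_act /= mulr1 vprojP. Qed.

Lemma vproj_fingen v : fingen (vproj v).
Proof.
exists 1%N, (fun=> vproj_of v 1) => x; exists (fun=> val x).
by rewrite big_ord_recl big_ord0 addr0 [LHS]vproj_ofE.
Qed.

Lemma vproj_projective v : projective (vproj v).
Proof.
move=> X Y f g _ _ fsurj; have [x fx] := fsurj (g (vproj_of v 1)).
have [h hE] : exists h : {linear vproj v -> X}, h =1 (fun m => x |> val m).
  apply: linear_of => a m n.
  by rewrite (congr1 (act x) (val_vproj_lin a m n)) actDr -actM.
by exists h => m; rewrite hE linear_act fx -linear_act -vproj_ofE.
Qed.

(** The regular module is the direct sum of the e_v B: extend each component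
    separately and add up. *)
Lemma selfinjective_of_vproj :
  (forall v, injective_module (vproj v)) -> selfinjective B.
Proof.
move=> injv X Y f g fX fY finj.
pose pr v (x : X) : vproj v := vproj_of v (g x).
have ex v : exists h : {linear Y -> vproj v}, forall x, h (f x) = vproj_of v (g x).
  have [g' g'E] : exists g' : {linear X -> vproj v}, g' =1 pr v.
    apply: linear_of => a x y; apply: val_inj.
    have e : g (a *: x + y) = (g x : B) * (a : B) + (g y : B) :> B by rewrite linearP.
    transitivity (videm v * ((g x : B) * (a : B) + (g y : B)) : B).
      exact: (congr1 ( *%R (videm v)) e).
    rewrite mulrDr mulrA; reflexivity.
  have [h hE] := injv v X Y f g' fX fY finj.
  by exists h => x; rewrite hE g'E.
pose h v := sval (cid (ex v)); have hE v : forall x, h v (f x) = vproj_of v (g x).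
  exact: svalP (cid (ex v)).
have [H HE] : exists H : {linear Y -> right_regular B}, H =1 (fun y => \sum_v val (h v y)).
  apply: linear_of => a x y; rewrite scaler_sumr -big_split; apply: eq_bigr => v _.
  by rewrite linearP; apply: (val_vproj_lin a (h v x) (h v y)).
exists H => x; rewrite HE (eq_bigr (fun v => videm v * g x)).
  by rewrite -mulr_suml sum_videm mul1r.
by move=> v _; rewrite hE.
Qed.

(** * Modules e_v B that are projective, injective and uniserial *)

(** The path conditions say that e_v B, for v the source of [p], is uniserial with
    basis the prefixes of [p], and that the indecomposable left projective at the
    target of [p] is uniserial too. *)
Definition proj_inj_path p : Prop := [/\ nonzero p,
  forall q, nonzero q -> qtgt q = qtgt p -> is_suffix q p,
  forall q, nonzero q -> qsrc q = qsrc p -> is_prefix q p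
  & injective_module (vproj (qsrc p))].

Lemma comp_triv p : qcomp p (trivial_path (qtgt p)) = Some p.
Proof. by rewrite qcompp_triv eqxx. Qed.

Lemma triv_comp p : qcomp (trivial_path (qsrc p)) p = Some p.
Proof. by rewrite qcomp_triv eqxx. Qed.

Lemma pcoefZ c b p : pcoef (c *: b) p = c * pcoef b p.
Proof.
have [x <-] := phi_surj b; rewrite -linearZ.
case: (boolP (nonzero p)) => [np|/negbTE np]; last by rewrite /pcoef np mulr0.
by rewrite !pcoef_phi // mcoeff_pathZ.
Qed.

Lemma pcoefB a b p : pcoef (a - b) p = pcoef a p - pcoef b p.
Proof. by rewrite -scaleN1r pcoefD pcoefZ mulN1r. Qed.

Lemma socle_act (M : lmodType B^c) (m : M) x p :
  m |> videm x = m -> (forall a, m |> barrow a = 0) -> p <> trivial_path x ->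
  m |> bpath p = 0.
Proof.
move=> mx ma ne; case wp: (qword p) => [|a s].
  have ep : p = trivial_path (qsrc p) by apply: qpath_eq.
  rewrite -mx actM videm_bpath; case: eqP => [ex|_]; last by rewrite act0r.
  by case: ne; rewrite ep -ex.
have [p' [c _]] := qpath_cons wp.
by rewrite -(bpath_comp c) -actM -/(barrow a) ma act0l.
Qed.

Lemma pcoef_fixed_suffix q r b : b * bpath q = b -> pcoef b r != 0 -> is_suffix q r.
Proof. by move=> <-; apply: pcoef_mulr_suffix. Qed.

Lemma vproj_src v r b : videm v * b = b -> pcoef b r != 0 -> qsrc r = v.
Proof.
by move=> <- /pcoef_mull_prefix /is_prefixE[<-].
Qed.

(** If all nonzero paths from [g] are prefixes of [p], then [p] spans the only
    simple submodule of e_g B: take the shortest prefix [r] in the support of [b]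
    and complete it to [p] by [t]; the longer prefixes in the support are killed
    by [t], because the result would be longer than [p]. *)
Lemma vproj_socle g p (b : B) : (forall q, nonzero q -> qsrc q = g -> is_prefix q p) ->
  qsrc p = g -> nonzero p -> videm g * b = b -> b != 0 ->
  exists t c, c != 0 /\ b * bpath t = c *: bpath p.
Proof.
move=> Hp sp np eb b0.
pose S n := `[<exists2 r, pcoef b r != 0 & size (qword r) = n>].
have [n /asboolP[r nr <-] rmin] : {n | S n & forall k, S k -> (n <= k)%N}.
  have ex : exists n, S n.
    have [r nr] := pcoef_neq0 b0.
    by exists (size (qword r)); apply/asboolP; exists r.
  by exists (ex_minn ex); case: ex_minnP.
have sr : qsrc r = g := vproj_src eb nr.
have [t ct] := Hp _ (pcoef_nonzero nr) sr.
exists t, (pcoef b r); split=> //.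
apply/eqP; rewrite -subr_eq0; apply/eqP/pcoef_eq0 => r'.
rewrite pcoefB pcoefZ.
case: (boolP (nonzero r')) => [nr'|/negbTE n0]; last by rewrite /pcoef n0 mulr0 subr0.
rewrite pcoef_bpath //; case: (p =P r') => [<-|ne].
  by rewrite (pcoef_mulr _ ct) // mulr1 subrr.
rewrite mulr0 subr0; apply/eqP/negPn/negP => n0; case: ne.
have [r'' c''] := pcoef_mulr_suffix n0.
rewrite (pcoef_mulr _ c'') // in n0.
have sr'' := vproj_src eb n0.
have le : (size (qword r) <= size (qword r''))%N.
  by apply: rmin; apply/asboolP; exists r''.
have [_ es ws] := iffLR (qcompE _ _ _) c''.
have [_ _ wp] := iffLR (qcompE _ _ _) ct.
apply/esym/is_prefix_antisym; first by apply: Hp; rewrite ?es.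
by rewrite ws wp !size_cat leq_add2r.
Qed.

(** Fix a homomorphism [f] from [M] to [B] with [f m] nonzero, and a path [p] in
    the support of [f m].
    - If [q] is nonzero and ends at [x], injectivity gives [y] with [y q = m], so
      [f m = f y q] and [q] is a suffix of [p].
    - If [q] starts where [p] does but is not a prefix of [p], the homomorphism
      sending [p] to [m] and [q] to [0] extends to an element [u]; comparing
      coefficients of [p] and [q], the coefficient of [f u] on the trivial path is
      both nonzero and zero.
    - With [y p = m], multiplication by [y] followed by [f] and by the projection
      onto e_g B, where g is the source of [p], is left multiplication by an
      element [u] that does not kill [p], hence is injective. It is therefore
      invertible, and e_g B is a retract of [M]. *)
Lemma socle_proj_inj_path (M : lmodType B^c) (m : M) x :
  injective_module M -> projective M -> fingen M ->
  m != 0 -> m |> videm x = m -> (forall a, m |> barrow a = 0) ->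
  exists p, proj_inj_path p /\ qtgt p = x.
Proof.
move=> injM prM fgM m0 mx ma.
have [f0 f0m] := projective_torsionless prM fgM m0.
pose f (z : M) : B := f0 z.
have fM z b : f (z |> b) = f z * b by rewrite /f linear_act.
have fm : f m != 0 by [].
have [p cp] := pcoef_neq0 fm; have np := pcoef_nonzero cp.
have fmx : f m * videm x = f m by rewrite -fM mx.
have tp : qtgt p = x.
  by rewrite -(is_suffix_tgt (pcoef_fixed_suffix fmx cp)).
have m_act b : pcoef b (trivial_path x) = 0 -> m |> b = 0.
  move=> b0; apply: act_eq0 => r nr; apply: socle_act mx ma _ => er.
  by rewrite er b0 eqxx in nr.
have lift q : nonzero q -> qtgt q = x -> exists y, y |> bpath q = m.
  move=> nq tq; apply: act_extend1 => // c qc; apply: m_act.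
  have ct : qcomp q (trivial_path x) = Some q by rewrite -tq comp_triv.
  rewrite -(pcoef_mull _ ct nq).
  by rewrite qc pcoef0.
have [y yp] := lift p np tp.
have sfxp q : nonzero q -> qtgt q = x -> is_suffix q p.
  by move=> nq /(lift q nq)[z zq]; move: cp; rewrite -zq fM => /pcoef_mulr_suffix.
have pfxp q : nonzero q -> qsrc q = qsrc p -> is_prefix q p.
  move=> nq sq; apply: contrapT => nqp.
  have npq : ~ is_prefix p q.
    case=> t ct; have : m |> bpath t = 0.
      apply: socle_act mx ma _ => et; apply: nqp.
      by move: ct; rewrite et -tp comp_triv => -[->]; apply: is_prefix_refl.
    move=> /(congr1 f); rewrite fM /f raddf0 -/(f m) => e0.
    have := pcoef_mulr (f m) ct nq.
    by move/eqP; rewrite e0 pcoef0 eq_sym (negbTE cp).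
  have [|u [up uq]] := @act_extend2 _ _ _ (bpath p) (bpath q) m 0 injM.
    move=> c d e0; rewrite act0l addr0; apply: m_act.
    have ct : qcomp p (trivial_path x) = Some p by rewrite -tp comp_triv.
    rewrite -(pcoef_mull _ ct np).
    have := congr1 (pcoef^~ p) e0; rewrite pcoefD pcoef0.
    case: (eqVneq (pcoef (bpath q * d) p) 0) => [->|/pcoef_mull_prefix//].
    by rewrite addr0.
  have e1 := pcoef_mulr (f u) (triv_comp p) np.
  have e2 := pcoef_mulr (f u) (triv_comp q) nq.
  move: cp; rewrite -up fM e1 -sq -e2 -fM uq /f raddf0.
  by rewrite pcoef0 eqxx.
exists p; split=> //; split; rewrite ?tp //.
set g := qsrc p in pfxp *.
pose u := videm g * f y.
have ep : bpath p = videm g * bpath p by rewrite videm_bpath eqxx.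
have up : u * bpath p != 0.
  rewrite /u -mulrA -fM yp; apply: contraNneq cp => e0.
  by rewrite -(pcoef_mull _ (triv_comp p) np) e0 pcoef0.
have u_inj b : videm g * b = b -> u * b = 0 -> b = 0.
  move=> eb ub; apply/eqP/negPn/negP => b0.
  have [t [c [c0 e]]] := vproj_socle pfxp erefl np eb b0.
  case/negP: up; have : u * (b * bpath t) = 0 by rewrite mulrA ub mul0r.
  by move/eqP; rewrite e -scalerAr scaler_eq0 (negbTE c0).
(* [u] acts on e_g B only; adding 1 - e_g makes it invertible in [B]. *)
pose U := u * videm g + (1 - videm g).
have eu : videm g * u = u by rewrite mulrA videm_idem.
have Ub b : videm g * b = b -> U * b = u * b.
  by move=> eb; rewrite mulrDl mulrBl mul1r -mulrA eb subrr addr0.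
have [V [UV VU]] : exists V, U * V = 1 /\ V * U = 1.
  apply: mull_inj_inv => b e0.
  have eU : videm g * U = u * videm g.
    by rewrite mulrDr mulrA eu mulrBr mulr1 videm_idem subrr addr0.
  have ub : u * (videm g * b) = 0 by rewrite mulrA -eU -mulrA e0 mulr0.
  have gb : videm g * b = 0 by apply: u_inj => //; rewrite mulrA videm_idem.
  by move: e0; rewrite mulrDl -mulrA gb mulr0 add0r mulrBl mul1r gb subr0.
have Ve : videm g * V = V * videm g.
  have eU : videm g * U = U * videm g.
    rewrite mulrDr mulrA eu mulrBr mulr1 videm_idem subrr addr0.
    by rewrite mulrDl mulrBl mul1r videm_idem subrr addr0 -mulrA videm_idem.
  by rewrite -[LHS]mul1r -VU -mulrA [U * _]mulrA -eU -[videm g * U * V]mulrA UV mulr1.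
move=> X Y j al fX fY jinj.
have [al' al'E] : exists al' : {linear X -> M}, al' =1 (fun z => y |> val (al z)).
  apply: linear_of => a z z'; rewrite linearP.
  by rewrite (congr1 (act y) (val_vproj_lin a (al z) (al z'))) actDr -actM.
have [be beE] := injM X Y j al' fX fY jinj.
have [h hE] : exists h : {linear Y -> vproj g}, h =1 (fun z => vproj_of g (V * f (be z))).
  apply: linear_of => a z z'; apply: val_inj.
  have e : f (be (a *: z + z')) = f (be z) * (a : B) + f (be z').
    by rewrite /f !linearP.
  transitivity (videm g * (V * f (be (a *: z + z')))); first by [].
  rewrite e !mulrDr [V * (_ * (a : B))]mulrA [videm g * (_ * (a : B))]mulrA; reflexivity.
exists h => z; apply: val_inj; rewrite hE beE al'E fM.
transitivity (V * (u * val (al z))); last first.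
  by rewrite -Ub ?vprojP // mulrA VU mul1r.
by rewrite /= mulrA Ve /u !mulrA.
Qed.

(** Every nonzero submodule of e_v B contains the socle element [p], so e_v B is
    not a sum of two nonzero modules. *)
Lemma proj_inj_path_indec p : proj_inj_path p -> indec_proj_inj (vproj (qsrc p)).
Proof.
case=> np _ pfxp injp; set g := qsrc p in pfxp injp *.
split=> //; [exact: vproj_fingen | | exact: vproj_projective].
have [one1 one0] : {z : vproj g | z != 0}.
  exists (vproj_of g (bpath p)); apply: contraNneq np => /(congr1 val) /=.
  by rewrite videm_bpath eqxx => ->.
split; first by move=> z0; move: one0; rewrite (z0 one1) eqxx.
move=> X Y [h [k hK kK]].
have hit (z : vproj g) : z != 0 -> exists b, z |> b = vproj_of g (bpath p).
  move=> z0; have vz0 : (val z : B) != 0.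
    by apply: contraNneq z0 => e; apply/eqP/val_inj.
  have [t [c [c0 e]]] := vproj_socle pfxp erefl np (vprojP z) vz0.
  exists (bpath t * (c^-1 *: 1)); apply: val_inj.
  rewrite val_vproj_act mulrA e -scalerAr mulr1 scalerA mulVf // scale1r.
  by rewrite /= videm_bpath eqxx.
have [X0|nX] := pselect (zero_module X); first by left.
have [Y0|nY] := pselect (zero_module Y); first by right.
have [x x0] : exists x : X, x != 0.
  by apply: contrapT => ne; case: nX => x; apply/eqP/negPn/negP => x0; case: ne; exists x.
have [y y0] : exists y : Y, y != 0.
  by apply: contrapT => ne; case: nY => y; apply/eqP/negPn/negP => y0; case: ne; exists y.
have hk z : h (k z) = z by exact: kK.
have k0 z : z != 0 -> k z != 0.
  by apply: contraNneq => e; rewrite -(hk z) e linear0.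
have x00 : (x, 0) != 0 :> X * Y by apply: contraNneq x0 => -[->].
have y00 : (0, y) != 0 :> X * Y by apply: contraNneq y0 => -[->].
have [a ea] := hit _ (k0 _ x00).
have [b eb] := hit _ (k0 _ y00).
have e1 : h (vproj_of g (bpath p)) = (x, 0) |> a by rewrite -ea linear_act hk.
have e2 : h (vproj_of g (bpath p)) = (0, y) |> b by rewrite -eb linear_act hk.
have h0 : h (vproj_of g (bpath p)) = 0.
  have [e3 e4] : (x |> a, 0 |> a) = (0 |> b, y |> b) := etrans (esym e1) e2.
  rewrite e1; transitivity (x |> a, (0 : Y) |> a); first reflexivity.
  by rewrite e3 !act0l.
case/negP: np; have /(congr1 val) : vproj_of g (bpath p) = 0.
  by apply: (can_inj hK); rewrite h0 linear0.
by rewrite /= videm_bpath eqxx => ->.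
Qed.

(** An isomorphism matches the socles, and the socle of e_v B is the simple module
    at the target of the path. *)
Lemma proj_inj_path_iso p q : proj_inj_path p -> proj_inj_path q ->
  mod_iso (vproj (qsrc p)) (vproj (qsrc q)) -> qtgt p = qtgt q.
Proof.
move=> [np _ pfxp _] [nq _ pfxq _] [h [k hK kK]].
pose z := vproj_of (qsrc p) (bpath p); pose w := h z.
have vz : (val z : B) = bpath p by rewrite /= videm_bpath eqxx.
have z0 : z != 0.
  by apply: contraNneq np => /(congr1 val); rewrite vz => ->.
have w0 : w != 0.
  by apply: contraNneq z0 => e; apply/eqP/(can_inj hK); rewrite -/w e linear0.
have vw0 : (val w : B) != 0.
  by apply: contraNneq w0 => e; apply/eqP/val_inj.
have [t [c [c0 e]]] := vproj_socle pfxq erefl nq (vprojP w) vw0.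
have n0 : z |> bpath t != 0.
  apply: contraNneq nq => z1.
  have : val (h (z |> bpath t)) = c *: bpath q by rewrite linear_act val_vproj_act e.
  rewrite z1 linear0 => /eqP; rewrite eq_sym scaler_eq0 (negbTE c0) => /eqP->//.
have nt : bpath p * bpath t != 0.
  by apply: contraNneq n0 => e0; apply/eqP/val_inj; rewrite val_vproj_act vz.
have [r cr nr] : exists2 r, qcomp p t = Some r & nonzero r.
  by move: nt; rewrite bpathM; case: (qcomp p t) => [r|]; [exists r | rewrite eqxx].
have [_ es ws] := iffLR (qcompE _ _ _) cr.
have er : r = p.
  apply/esym/is_prefix_antisym; first by exists t.
  exact/is_prefix_size/pfxp.
have et : t = trivial_path (qtgt p).
  have [ts _ _] := iffLR (qcompE _ _ _) cr.
  apply: qpath_eq => //; apply/eqP; rewrite -size_eq0 -(eqn_add2l (size (qword p))) addn0.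
  by rewrite -size_cat -ws er.
have : bpath q * videm (qtgt p) != 0.
  have e' : c *: (bpath q * videm (qtgt p)) = c *: bpath q.
    by rewrite scalerAl -e et -mulrA -/(videm _) videm_idem.
  apply: contraNneq nq => e0; move/eqP: e'.
  by rewrite e0 scaler0 eq_sym scaler_eq0 (negbTE c0).
by rewrite bpath_videm; case: (qtgt q =P qtgt p) => [-> //|_]; rewrite eqxx.
Qed.

(** * Injective coresolutions whose first terms are projective *)

Variable len_max : nat.
Hypothesis bpath_long : forall p, (len_max <= size (qword p))%N -> bpath p = 0.

Lemma nonzero_arrow_comp p a : bpath p * barrow a != 0 ->
  exists2 r, qcomp p (arrow_path a) = Some r & nonzero r.
Proof. by rewrite bpathM; case: qcomp => [r|] /=; [exists r | rewrite eqxx]. Qed.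

Lemma right_maximal_extension r : nonzero r ->
  exists w, [/\ nonzero w, is_prefix r w & forall a, bpath w * barrow a = 0].
Proof.
have [k] := ubnP (len_max - size (qword r)); elim: k r => // k IHk r le nr.
have [mx|] := pselect (forall a, bpath r * barrow a = 0).
  by exists r; split=> //; apply: is_prefix_refl.
move/existsNP=> [a /eqP/nonzero_arrow_comp[r' c nr']].
have sz : size (qword r') = (size (qword r)).+1.
  by have [_ _ ->] := iffLR (qcompE _ _ _) c; rewrite size_cat addn1.
have lt : (size (qword r) < len_max)%N.
  by rewrite ltnNge; apply: contraNN nr => /bpath_long->.
have [|w [nw pw mw]] := IHk r' _ nr'.
  by rewrite sz subnS prednK ?subn_gt0.
by exists w; split=> //; apply: is_prefix_trans pw; exists (arrow_path a).
Qed.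

Lemma longest_path v : nonzero (trivial_path v) ->
  exists w, [/\ nonzero w, qsrc w = v &
    forall r, nonzero r -> qsrc r = v -> (size (qword r) <= size (qword w))%N].
Proof.
move=> nv; pose S n := `[<exists r, [/\ nonzero r, qsrc r = v & size (qword r) = n]>].
have ex : exists n, S n.
  by exists 0%N; apply/asboolP; exists (trivial_path v).
have bnd n : S n -> (n <= len_max)%N.
  move=> /asboolP[r [nr _ <-]]; rewrite leqNgt; apply: contraNN nr => lt.
  by rewrite bpath_long // ltnW.
case: (ex_maxnP ex bnd) => n /asboolP[w [nw sw <-]] mx.
by exists w; split=> // r nr sr; apply: mx; apply/asboolP; exists r.
Qed.

Lemma nonzero_vertex i : ~ injective_module (vproj i) -> nonzero (trivial_path i).
Proof.
move=> ninj; apply/negP => /eqP e0; apply: ninj => X Y f g _ _ _.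
have [h hE] : exists h : {linear Y -> vproj i}, h =1 fun=> 0.
  by apply: linear_of => a x y; rewrite scaler0 addr0.
exists h => x; rewrite hE; apply: val_inj.
by rewrite -[RHS]vprojP -[LHS]vprojP -/(videm i) /videm e0 !mul0r.
Qed.

Section Coresolution.
Variables (I : nat -> lmodType B^c) (eps : {linear right_regular B -> I 0%N}).
Variable (d : forall n, {linear I n -> I n.+1}).
Hypothesis I_fg : forall n, fingen (I n).
Hypothesis I_inj : forall n, injective_module (I n).
Hypothesis eps_inj : injective eps.
Hypothesis exact0 : exact_at eps (d 0%N).
Hypothesis exactS : forall n, exact_at (d n) (d n.+1).

Lemma epsM (b c : B) : eps b |> c = eps (b * c).
Proof. by rewrite -linear_act. Qed.

Lemma eps_eq0 (b : B) : eps b = 0 -> b = 0.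
Proof. by move=> e; apply: eps_inj; rewrite e linear0. Qed.

Lemma ker_d0 (y : I 0%N) : d 0%N y = 0 -> exists b : B, y = eps b.
Proof. by case/exact0=> b ->; exists b. Qed.

Lemma d0_eps (b : B) : d 0%N (eps b) = 0.
Proof. by apply/exact0; exists b. Qed.

Lemma right_maximal_proj_inj w : projective (I 0%N) -> nonzero w ->
  (forall a, bpath w * barrow a = 0) -> exists p, proj_inj_path p /\ qtgt p = qtgt w.
Proof.
move=> prI nw mw; apply: (@socle_proj_inj_path (I 0%N) (eps (bpath w))) => //.
- by apply: contraNneq nw => /eps_eq0->.
- by rewrite epsM bpath_videm eqxx.
- by move=> a; rewrite epsM mw; apply: linear0.
Qed.

Lemma arrow_is_prefix a r : is_prefix (arrow_path a) r -> exists s, qword r = a :: s.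
Proof. by case/is_prefixE=> _ /prefixP[s ->]; exists s. Qed.

(** Extend the homomorphism from the radical of e_j B to [I 0] which embeds the
    branch [a] and kills all other arrows. The resulting element of [I 0] is not
    in the image of [B], since it would have to act as the identity on [a] and as
    zero on [b]; but its products with arrows are. Its class in [I 1] therefore
    generates a simple module at [j]. *)
Lemma branch_target (j : vertex Q) (a b : arrow Q) : projective (I 0%N) -> projective (I 1%N) ->
  src a = j -> src b = j -> a != b -> nonzero (arrow_path a) -> nonzero (arrow_path b) ->
  exists p, proj_inj_path p /\ qtgt p = j.
Proof.
move=> pr0 pr1 sa sb ab na nb.
have [|y yE] := @act_extend _ _ (I 0%N) _ barrow
    (fun c => if c == a then eps (barrow a) else 0) (@I_inj 0%N).
  move=> be e0; rewrite (bigD1 a) //= eqxx [X in _ + X]big1 ?addr0; last first.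
    by move=> c /negbTE->; rewrite act0l.
  rewrite epsM (_ : barrow a * be a = 0) ?linear0 //; apply: pcoef_eq0 => r.
  apply/eqP/negPn/negP => n0; move: (n0).
  have := congr1 (pcoef^~ r) e0; rewrite pcoef0 pcoef_sum (bigD1 a) //= big1.
    by rewrite addr0 => ->; rewrite eqxx.
  move=> c ca; apply/eqP/negPn/negP => /pcoef_mull_prefix/arrow_is_prefix[s es].
  have [s' es'] := arrow_is_prefix (pcoef_mull_prefix n0).
  by move: es; rewrite es' => -[e _]; rewrite e eqxx in ca.
pose z := y |> videm j.
have zE c : z |> barrow c = if c == a then eps (barrow a) else 0.
  rewrite /z actM videm_bpath -yE /=; case: (j =P src c) => // ne.
  by rewrite act0r yE; case: eqP => // ca; case: ne; rewrite ca.
apply: (@socle_proj_inj_path (I 1%N) (d 0%N z)) => //.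
- apply/eqP => /ker_d0[be ebe].
  have e1 : be * barrow a = barrow a.
    by apply: eps_inj; rewrite -epsM -ebe zE eqxx.
  have e2 : be * barrow b = 0.
    by apply: eps_eq0; rewrite -epsM -ebe zE eq_sym (negbTE ab).
  have := pcoef_mulr be (triv_comp (arrow_path a)) na.
  have := pcoef_mulr be (triv_comp (arrow_path b)) nb.
  rewrite -/(barrow a) -/(barrow b) e1 e2 pcoef0 /qsrc /= sa sb => <- /eqP.
  by rewrite pcoef_bpath // eqxx oner_eq0.
- by rewrite -linear_act /z actM videm_idem.
- move=> c; rewrite -linear_act zE; case: eqP => _; last exact: linear0.
  exact: d0_eps.
Qed.

(** Here [pb = u qa wb], so [qa wb] is a nonzero path from the source of [pa]. It
    is then a prefix of [pa = qa wa], although [wa] and [wb] start with different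
    arrows. *)
Lemma branch_nested (a b : arrow Q) wa wb pa pb qa qb :
  a != b -> is_prefix (arrow_path a) wa -> is_prefix (arrow_path b) wb ->
  proj_inj_path pa -> proj_inj_path pb -> qcomp qa wa = Some pa -> qcomp qb wb = Some pb ->
  is_suffix qa qb -> False.
Proof.
move=> ab /arrow_is_prefix[s es] /arrow_is_prefix[t et] [_ _ pfxa _] [nb _ _ _] ca cb [u cu].
have [tu su wu] := iffLR (qcompE _ _ _) cu.
have [tb sb wb'] := iffLR (qcompE _ _ _) cb.
have [ta sa wa'] := iffLR (qcompE _ _ _) ca.
have [x [y [cxy wx wy]]] : exists x y, [/\ qcomp x y = Some pb, qword x = qword u
    & qword y = qword qa ++ qword wb].
  by apply: qpath_cat; rewrite wb' wu catA.
have [tx sx _] := iffLR (qcompE _ _ _) cxy.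
have sy : qsrc y = qsrc qa.
  by rewrite -tx -tu /qtgt wx -sx sb su.
have [_ ny] := nonzero_comp cxy nb.
have /is_prefixE[_] : is_prefix y pa by apply: pfxa => //; rewrite sy.
rewrite wy wa' et es; move/prefixP=> [v].
rewrite -catA => /eqP; rewrite eqseq_cat // eqxx /= => /eqP[e _].
by rewrite e eqxx in ab.
Qed.

(** Two distinct nonzero arrows out of a vertex j would extend to right maximal
    paths [wa], [wb], and these to projective-injective paths [pa = qa wa],
    [pb = qb wb]. As j is itself the target of a projective-injective path, the
    paths [qa] and [qb] ending at j are suffixes of one path, so one is a suffix of the other. *)
Lemma arrow_out_unique (a b : arrow Q) : projective (I 0%N) -> projective (I 1%N) ->
  nonzero (arrow_path a) -> nonzero (arrow_path b) -> src a = src b -> a = b.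
Proof.
move=> pr0 pr1 na nb ab; apply/eqP/negPn/negP => ne.
have [pj [[_ sfxj _ _] tj]] := branch_target pr0 pr1 ab erefl ne na nb.
have ext c : nonzero (arrow_path c) -> src c = src b ->
    exists w p q, [/\ is_prefix (arrow_path c) w, proj_inj_path p,
      qcomp q w = Some p & is_suffix q pj].
  move=> nc sc; have [w [nw pw mw]] := right_maximal_extension nc.
  have [p [gp tp]] := right_maximal_proj_inj pr0 nw mw.
  have [np sfxp _ _] := gp; have [q cq] := sfxp w nw (esym tp).
  have [nq _] := nonzero_comp cq np.
  exists w, p, q; split=> //; apply: sfxj => //.
  have [-> _ _] := iffLR (qcompE _ _ _) cq.
  by case/is_prefixE: pw => <- _; rewrite tj -sc.
have [wa [pa [qa [wpa ga ca sa]]]] := ext a na ab.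
have [wb [pb [qb [wpb gb cb sb]]]] := ext b nb erefl.
case/orP: (leq_total (size (qword qa)) (size (qword qb))) => le.
  exact: (branch_nested ne wpa wpb ga gb ca cb (is_suffix_comparable sa sb le)).
rewrite eq_sym in ne.
exact: (branch_nested ne wpb wpa gb ga cb ca (is_suffix_comparable sb sa le)).
Qed.

Lemma nonzero_paths_nested p q : projective (I 0%N) -> projective (I 1%N) ->
  nonzero p -> nonzero q -> qsrc p = qsrc q -> (size (qword p) <= size (qword q))%N ->
  is_prefix p q.
Proof.
move=> pr0 pr1; have [n] := ubnP (size (qword p)); elim: n p q => // n IHn p q.
case wp : (qword p) => [|a s].
  by move=> _ np nq e _; apply/is_prefixE; split=> //; rewrite wp; apply: prefix0s.
case wq : (qword q) => [|b t] //= lt np nq e le.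
have [p' [cp wp']] := qpath_cons wp; have [q' [cq wq']] := qpath_cons wq.
have [na np'] := nonzero_comp cp np; have [nb nq'] := nonzero_comp cq nq.
have [tp sp _] := iffLR (qcompE _ _ _) cp; have [tq sq _] := iffLR (qcompE _ _ _) cq.
have ab : a = b.
  by apply: arrow_out_unique => //; move: sp sq; rewrite /qsrc /= => <- <-.
subst b.
have /is_prefixE[_] : is_prefix p' q' by apply: IHn; rewrite ?wp' ?wq' -?tp -?tq.
by move=> pf; apply/is_prefixE; split=> //; rewrite wp wq prefix_cons eqxx -wp' -wq'.
Qed.

(** [xi] generates a uniserial submodule of the cosyzygy [ker (d k)], with basis
    the products of [xi] with the prefixes of [w]. The last clause is a purity
    condition: the socle element [xi w] is not reached by any path strictly longer
    than [w] starting from any element of the cosyzygy. It stands in for the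
    module generated by [xi] being a direct summand, and keeps the next segment
    nonzero. *)
Definition segment k (xi : I k) w := [/\ d k xi = 0, nonzero w /\ xi |> bpath w != 0,
  xi |> videm (qsrc w) = xi,
  forall r, qsrc r = qsrc w -> ~ is_prefix r w -> xi |> bpath r = 0
  & forall z q, d k z = 0 -> (0 < size (qword q))%N ->
      z |> (bpath q * bpath w) <> xi |> bpath w].

Lemma segment_socle k (xi : I k) w : projective (I k) -> segment xi w ->
  exists p, proj_inj_path p /\ qtgt p = qtgt w.
Proof.
move=> prI [_ [nw xw] sx ax _]; apply: (@socle_proj_inj_path (I k) (xi |> bpath w)) => //.
  by rewrite actM bpath_videm eqxx.
move=> a; rewrite actM bpathM; case c : qcomp => [r|] /=; last exact: act0r.
have [_ er wr] := iffLR (qcompE _ _ _) c.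
apply: ax => // /is_prefix_size; rewrite wr size_cat addn1.
by rewrite ltnn.
Qed.

(** By [nonzero_paths_nested], e_i B is uniserial and spanned by the prefixes of
    its longest path. *)
Lemma segment0 i : nonzero (trivial_path i) -> projective (I 0%N) -> projective (I 1%N) ->
  exists w, qsrc w = i /\ segment (eps (videm i)) w.
Proof.
move=> ni pr0 pr1; have [w [nw sw mw]] := longest_path ni.
exists w; split=> //.
have ew : videm i * bpath w = bpath w by rewrite videm_bpath sw eqxx.
split.
- exact: d0_eps.
- by split=> //; rewrite epsM ew; apply: contraNneq nw => /eps_eq0->.
- by rewrite epsM sw videm_idem.
- move=> r sr nr; rewrite epsM videm_bpath -sw sr eqxx.
  case: (boolP (nonzero r)) => [nzr|]; last by rewrite negbK => /eqP->; apply: linear0.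
  by case: nr; apply: nonzero_paths_nested => //; apply: mw; rewrite // sr.
move=> z q /ker_d0[b ->] q0; rewrite !epsM ew => /eps_inj e.
have := pcoef_mulr (b * bpath q) (triv_comp w) nw.
rewrite -mulrA e pcoef_bpath // eqxx => /esym/eqP c1.
have /is_suffix_size : is_suffix q (trivial_path (qsrc w)).
  by apply: (@pcoef_mulr_suffix _ _ b); rewrite (eqP c1) oner_neq0.
by rewrite /= leqNgt q0.
Qed.

Lemma ker_dS k (z : I k.+1) : d k.+1 z = 0 -> exists y, z = d k y.
Proof. by move/exactS. Qed.

(** Injectivity of [I k] yields [b] with [b q = xi]. With [q = w' a], the element
    [d k b] is killed by [a] after [w'] because [xi] lies in the kernel of [d k],
    and purity of [xi w] shows both that [d k b w'] is nonzero and that it is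
    again pure. *)
Lemma segment_step k (xi : I k) w p q : segment xi w -> proj_inj_path p ->
  qcomp q w = Some p -> (0 < size (qword q))%N ->
  exists (xi' : I k.+1) w' a, [/\ segment xi' w', nonzero (arrow_path a),
    src a = qtgt w', tgt a = qsrc w &
    qsrc w' = qsrc p /\ (size (qword w') < size (qword p))%N].
Proof.
move=> [dxi [nw xw] sx ax pure] [np sfxp pfxp _] cq q0.
have [tq sq wp] := iffLR (qcompE _ _ _) cq.
have [nq _] := nonzero_comp cq np.
have [b bE] : exists b : I k, b |> bpath q = xi.
  apply: act_extend1 => // c qc; apply: act_eq0 => r nr.
  case: (qsrc r =P qsrc w) => [er|ne]; last first.
    by rewrite -sx actM videm_bpath; case: eqP => [e|_]; [case: ne | rewrite act0r].
  apply: ax => //; case=> t ct; case/eqP: nr.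
  have [r' cr'] : exists r', qcomp q r = Some r'.
    by have := qcompP q r; rewrite tq er eqxx => -[r' ? _]; exists r'.
  rewrite -(pcoef_mull c cr') ?qc ?pcoef0 //.
  have : qcomp r' t = Some p.
    have := qcompA q r t; rewrite cr' ct /= => <-; exact: cq.
  by move=> c'; case: (nonzero_comp c' np).
have [s [a eqs]] : exists s a, qword q = s ++ [:: a].
  by case/lastP: (qword q) q0 => // s a _; exists s, a; rewrite cats1.
have [w' [qa [cwa ww' wqa]]] := qpath_cat eqs.
have [twa swa _] := iffLR (qcompE _ _ _) cwa.
have eqa : qa = arrow_path a.
  apply: qpath_eq => //; have := qpath_walk qa.
  by rewrite -/(qsrc qa) -/(qword qa) wqa /= andbT => /eqP <-.
subst qa; have [nw' na] := nonzero_comp cwa nq.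
have pw : bpath w' * bpath (arrow_path a) * bpath w = bpath p.
  by rewrite (bpath_comp cwa) (bpath_comp cq).
have xp : b |> bpath p = xi |> bpath w by rewrite -(bpath_comp cq) -actM bE.
have sz : (size (qword w') < size (qword p))%N.
  by rewrite wp eqs ww' -catA size_cat -[X in (X < _)%N]addn0 ltn_add2l.
(* Cutting [b] down to the source of [q] keeps its products with the paths that
   start there. *)
pose b' := b |> videm (qsrc q).
have b'E r : qsrc r = qsrc q -> b' |> bpath r = b |> bpath r.
  by move=> e; rewrite /b' actM videm_bpath e eqxx.
exists (d k b'), w', a; split=> //; last 2 first.
- by rewrite -tq (qtgt_comp cwa).
- by rewrite -swa sq.
split.
- by apply/exactS; exists b'.
- split=> //; rewrite -linear_act; apply/eqP => e0.
  apply: (pure _ (arrow_path a) e0) => //.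
  by rewrite actM mulrA pw b'E ?xp.
- by rewrite -linear_act /b' actM -swa videm_idem.
- move=> r sr nr; rewrite -linear_act b'E ?swa //.
  case: (boolP (nonzero r)) => [nzr|]; last by rewrite negbK => /eqP->; rewrite act0r linear0.
  have prp : is_prefix r p by apply: pfxp => //; rewrite sr -swa sq.
  have pqp : is_prefix q p by exists w.
  have qr : is_prefix q r.
    case: (is_prefix_comparable prp pqp) => // rq.
    have wq : is_prefix w' q by exists (arrow_path a).
    case: (is_prefix_comparable rq wq) => [//|wr].
    rewrite (is_prefix_antisym rq); first exact: is_prefix_refl.
    rewrite eqs size_cat addn1 -ww' ltnNge; apply/negP => le.
    by apply: nr; rewrite (is_prefix_antisym wr le); apply: is_prefix_refl.
  case: qr => t ct.
  by rewrite -(bpath_comp ct) -actM bE linear_act dxi act0l.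
move=> z u dz u0 e.
have [y ey] := ker_dS dz.
have e0 : d k (b' |> bpath w' - y |> (bpath u * bpath w')) = 0.
  by rewrite linearB (linear_act _ b') (linear_act _ y) -ey -e subrr.
apply: (pure _ (arrow_path a) e0) => //.
have e1 : b' |> bpath w' |> (bpath (arrow_path a) * bpath w) = xi |> bpath w.
  by rewrite actM mulrA pw b'E ?xp.
rewrite actBl e1 actM -[bpath u * bpath w' * _]mulrA [bpath w' * _]mulrA pw.
rewrite bpathM; case cu : qcomp => [r|] /=; last by rewrite act0r subr0.
case: (boolP (nonzero r)) => [nzr|]; last by rewrite negbK => /eqP->; rewrite act0r subr0.
have := is_suffix_size (sfxp r nzr (qtgt_comp cu)).
by have [_ _ ->] := iffLR (qcompE _ _ _) cu;
  rewrite size_cat -[X in (_ <= X)%N]add0n leq_add2r leqNgt u0.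
Qed.

Definition segment_src i (P : nat -> qpath Q) k := if k is k'.+1 then qsrc (P k') else i.

(** The equality of two socle vertices is traced back along these arrows, each
    leading from a socle to the source of the segment before it. *)
Definition linked i (P : nat -> qpath Q) n := forall k, (0 < k <= n)%N ->
  exists a, [/\ nonzero (arrow_path a), src a = qtgt (P k) & tgt a = segment_src i P k.-1].

Lemma proj_inj_path_src p q : proj_inj_path p -> proj_inj_path q -> qsrc p = qsrc q -> p = q.
Proof.
move=> [np _ pfxp _] [nq _ pfxq _] e; apply: is_prefix_antisym; first exact: pfxq.
by apply/is_prefix_size/pfxp.
Qed.

(** Were [q] trivial, the segment would be a whole projective-injective module. For
    [n = 0] this makes e_i B injective; for later [n] the path [P n] would be
    projective-injective with the same source as the longer path [P n.-1]. *)
Lemma segment_extend i P n (xi : I n) : ~ injective_module (vproj i) ->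
  projective (I n) -> segment xi (P n) -> qsrc (P n) = segment_src i P n ->
  (forall k, (k < n)%N -> proj_inj_path (P k)) ->
  ((0 < n)%N -> (size (qword (P n)) < size (qword (P n.-1)))%N) ->
  exists p q, [/\ proj_inj_path p, qcomp q (P n) = Some p & (0 < size (qword q))%N].
Proof.
move=> ninj prn inx sP gP szP; have [p [gp tp]] := segment_socle prn inx.
have [np sfxp _ injp] := gp.
have [_ [nw _] _ _ _] := inx.
have [q cq] := sfxp _ nw (esym tp); exists p, q; split=> //.
rewrite lt0n; apply/negP => q0.
have [tq sq wp] := iffLR (qcompE _ _ _) cq.
have sp : qsrc p = qsrc (P n).
  by rewrite sq -tq /qtgt (size0nil (eqP q0)).
have szp : size (qword p) = size (qword (P n)).
  by rewrite wp size_cat (eqP q0).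
case: n P xi prn inx sP gP szP tp nw cq tq sp wp szp =>
  [|n] P xi prn inx sP gP szP tp nw cq tq sp wp szp.
  by apply: ninj; rewrite sP /= in sp; rewrite -sp.
have e : p = P n by apply: proj_inj_path_src => //; [apply: gP | rewrite sp sP].
by have := szP isT; rewrite -szp e ltnn.
Qed.

(** [P k] is the [k]-th projective-injective path for [k < n], while [P n] is the
    path of the current segment, not yet completed on the left. *)
Lemma segment_chain i n : nonzero (trivial_path i) -> ~ injective_module (vproj i) ->
  projective (I 0%N) -> projective (I 1%N) ->
  (forall k, (k < n)%N -> projective (I k)) ->
  exists (P : nat -> qpath Q) (xi : I n), [/\ segment xi (P n),
    qsrc (P n) = segment_src i P n, forall k, (k < n)%N -> proj_inj_path (P k), linked i P n
    & (0 < n)%N -> (size (qword (P n)) < size (qword (P n.-1)))%N].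
Proof.
move=> ni ninj pr0 pr1; elim: n => [_|n IHn prI].
  have [w [sw inw]] := segment0 ni pr0 pr1.
  exists (fun=> w), (eps (videm i)); split=> //; by case.
have [k kn|P [xi [inx sP gP lP szP]]] := IHn; first by apply: prI; apply: ltnW.
have [p [q [gp cq q0]]] := segment_extend ninj (prI n (ltnSn n)) inx sP gP szP.
have [xi' [w' [a [inx' na sa ta [sw' szw']]]]] := segment_step inx gp cq q0.
pose P' k := if k == n then p else if k == n.+1 then w' else P k.
have P'lt k : (k < n)%N -> P' k = P k.
  by move=> kn; rewrite /P' !ltn_eqF // ltnW.
have P'n : P' n = p by rewrite /P' eqxx.
have P'n1 : P' n.+1 = w' by rewrite /P' eqxx gtn_eqF.
have top k : (k <= n)%N -> segment_src i P' k = segment_src i P k.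
  by case: k => // k kn /=; rewrite P'lt.
exists P', xi'; split; rewrite ?P'n1 //=; rewrite ?P'n //.
- move=> k; rewrite ltnS leq_eqVlt => /orP[/eqP->|kn]; first by rewrite P'n.
  by rewrite P'lt //; apply: gP.
move=> k /andP[k0]; rewrite leq_eqVlt => /orP[/eqP->|].
  by exists a; rewrite P'n1 /= top // -sP.
rewrite ltnS => kn; have [b [nb sb tb]] := lP k (introT andP (conj k0 kn)).
exists b; rewrite top ?(leq_trans (leq_pred k)) //; split=> //.
move: kn; rewrite leq_eqVlt => /orP[/eqP ek|kn]; last by rewrite P'lt.
by rewrite sb ek P'n (qtgt_comp cq).
Qed.

Lemma proj_inj_sequence i n : nonzero (trivial_path i) -> ~ injective_module (vproj i) ->
  projective (I 0%N) -> projective (I 1%N) ->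
  (forall k, (k <= n)%N -> projective (I k)) ->
  exists P : nat -> qpath Q, (forall k, (k <= n)%N -> proj_inj_path (P k)) /\ linked i P n.
Proof.
move=> ni ninj pr0 pr1 prI.
have [k kn|P [xi [inx sP gP lP szP]]] := @segment_chain i n ni ninj pr0 pr1.
  by apply: prI; apply: ltnW.
have [p [q [gp cq _]]] := segment_extend ninj (prI n (leqnn n)) inx sP gP szP.
exists (fun k => if k == n then p else P k); split.
  move=> k; rewrite leq_eqVlt => /orP[->//|kn]; rewrite ltn_eqF //; exact: gP.
move=> k /andP[k0 kn]; have [a [na sa ta]] := lP k (introT andP (conj k0 kn)).
exists a; split=> //.
  by case: eqP => // ek; rewrite sa ek (qtgt_comp cq).
rewrite ta; case: k k0 kn {sa ta} => // [[|k]] //= _ kn.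
by rewrite ltn_eqF // ltnW.
Qed.

(** If two targets agree then so do the arrows leaving them, hence the sources of
    the paths two places earlier, hence these paths. Descending by two places
    from an odd index ends at [1], where the arrow leads to [i]. *)
Lemma odd_socles_distinct i P n (a b : nat) : ~ injective_module (vproj i) ->
  projective (I 0%N) -> projective (I 1%N) ->
  (forall k, (k <= n)%N -> proj_inj_path (P k)) -> linked i P n ->
  odd a -> (a < b <= n)%N -> qtgt (P a) <> qtgt (P b).
Proof.
move=> ninj pr0 pr1 gP lP; have [m] := ubnP a.
elim: m a b => // m IHm a b am oa /andP[ab bn] e.
have a0 : (0 < a)%N by case: a oa {am ab e}.
have [al [nal sal tal]] := lP a (introT andP (conj a0 (leq_trans (ltnW ab) bn))).
have [be [nbe sbe tbe]] := lP b (introT andP (conj (leq_trans a0 (ltnW ab)) bn)).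
have eab : al = be by apply: arrow_out_unique; rewrite ?sal ?sbe.
have {tal tbe eab} : segment_src i P a.-1 = segment_src i P b.-1 by rewrite -tal -tbe eab.
case: b ab bn {sbe e} => [|[|b]] //= ab bn; first by rewrite ltnS leqNgt a0 in ab.
have gb : proj_inj_path (P b) by apply: gP; rewrite -ltnS ltnW // ltnW.
case: a am oa a0 ab {sal} => [|[|a]] //= am oa _ ab e.
  by have [_ _ _] := gb; rewrite -e.
have ga : proj_inj_path (P a) by apply: gP; apply: leq_trans bn; rewrite ltnW // ltnW // ltnW.
have := proj_inj_path_src ga gb e => e'.
apply: (IHm a b); rewrite ?e' //.
- by move: am; rewrite !ltnS => /ltnW.
- by move: oa; rewrite negbK.
by rewrite -ltnS -ltnS ab -ltnS ltnW // ltnW.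
Qed.

End Coresolution.

End MonomialAlgebra.

(** * Counting projective-injective modules *)

Lemma projective_terms_lt (K : fieldType) (B : falgType K) (s m : nat)
    (I : nat -> lmodType B^c) (eps : {linear right_regular B -> I 0%N})
    (d : forall n, {linear I n -> I n.+1}) :
  monomial_algebra B -> ~ selfinjective B -> num_indec_proj_inj B s ->
  minimal_injective_coresolution eps d ->
  (forall k, (k <= m)%N -> projective (I k)) -> (m < 2 * s)%N.
Proof.
move=> [Q [rels [adm [phi [surj ker]]]]] nself [M [_ M_inj M_surj]].
move=> [fgI injI eps_inj ex0 exS _ _] prI; rewrite ltnNge; apply/negP => le.
have [len_max /(_ _ _)/ker long] := long_paths_vanish adm.
have pr0 : projective (I 0%N) by apply: prI.
have [i ninj] : exists i, ~ injective_module (vproj phi i).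
  by apply/existsNP => injv; apply: nself; apply: selfinjective_of_vproj injv.
have ni := nonzero_vertex ninj.
have ex p : proj_inj_path phi p -> exists j, mod_iso (vproj phi (qsrc p)) (M j).
  by move=> gp; apply: M_surj; apply: proj_inj_path_indec gp.
have s_gt0 : (0 < s)%N.
  have [w [nw _ mw]] := right_maximal_extension long ni.
  have [p [gp _]] := right_maximal_proj_inj surj ker fgI injI eps_inj pr0 nw mw.
  by have [j _] := ex p gp; apply: leq_trans (ltn_ord j).
have pr1 : projective (I 1%N).
  by apply: prI; apply: leq_trans le; rewrite muln_gt0.
have [P [gP lP]] : exists P : nat -> qpath Q,
    (forall k, (k <= 2 * s)%N -> proj_inj_path phi (P k)) /\ linked phi i P (2 * s).
  apply: (proj_inj_sequence surj ker long fgI injI eps_inj ex0 exS) => // k kn.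
  by apply: prI; apply: leq_trans kn le.
(* The indices 1, 3, ..., 2s-1 and 2s: of any two, the smaller one is odd. *)
pose kk (j : 'I_s.+1) := if (j < s)%N then (2 * j).+1 else (2 * s)%N.
have kk_le j : (kk j <= 2 * s)%N.
  by rewrite /kk; case: ifP => // lt; rewrite !mul2n ltn_double.
have /choice[f fE] : forall j, exists x, mod_iso (vproj phi (qsrc (P (kk j)))) (M x).
  by move=> j; apply/ex/gP.
have f_neq (j j' : 'I_s.+1) : (j < j')%N -> f j <> f j'.
  move=> lt e; have js : (j < s)%N by apply: leq_trans lt _; rewrite -ltnS.
  apply: (odd_socles_distinct surj ker long fgI injI eps_inj ex0 ninj pr0 pr1 gP lP)
    (proj_inj_path_iso surj ker (gP _ (kk_le j)) (gP _ (kk_le j')) _).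
  - by rewrite /kk js mul2n /= odd_double.
  - rewrite kk_le andbT /kk js; case: ifP => _; rewrite !mul2n.
      by rewrite ltnS ltn_double.
    by rewrite ltn_Sdouble.
  - apply: mod_iso_trans (fE j) _; rewrite e; exact: mod_iso_sym.
have f_inj : injective f.
  move=> j j' e; apply: val_inj; case: (ltngtP j j') => //.
    by move/f_neq.
  by move/f_neq => ne; case: ne.
by have := leq_card f f_inj; rewrite !card_ord ltnn.
Qed.

Theorem theorem2p18 (K : fieldType) (B : falgType K) (s : nat) (e : enat)
    (B_connected : connected_algebra B)
    (B_monomial : monomial_algebra B)
    (B_not_selfinjective : ~ selfinjective B)
    (s_count : num_indec_proj_inj B s)
    (e_domdim : domdim_is B e) :
  enat_le e (Some (2 * s)%N).
Proof.
have [I [eps [d [res lead]]]] := e_domdim.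
have lt := projective_terms_lt B_monomial B_not_selfinjective s_count res.
case: lead => [[_ ->] //|[pr0 [t [_ lub] ->]]].
have s_gt0 : (0 < 2 * s)%N by apply: (lt 0%N) => k; rewrite leqn0 => /eqP->.
have : enat_le t (Some (2 * s).-1).
  by apply: lub => m /lt m_lt; rewrite /= -ltnS prednK.
by case: t {lub} => [t|] //= le_t; rewrite -(prednK s_gt0) ltnS.
Qed.
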